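(* Let $(P,Q)$ be a pair of real quadratic forms on $\mathbb{R}^3$ that is equivalent to one of $(\xi_1^2+\xi_2^2,\ \xi_3^2)$, $(\xi_1^2-\xi_2^2,\ \xi_3^2)$, $(\xi_1\xi_2+\xi_3^2,\ \xi_1^2)$, $(\xi_1\xi_2,\ \xi_1\xi_3)$, and let $S=\{(\xi,P(\xi),Q(\xi)):\xi\in[-1,1]^3\}\subset\mathbb{R}^5$. If $q<4$, or if $q\ge4$ and $p<\frac{q}{q-3}$, then there is no constant $C<\infty$ such that $$\|E^Sf\|_{L^q(\mathbb{R}^5)}\le C\,\|f\|_{L^p(\mathbb{R}^3)}$$ holds for every function $f$.
   Context: Two pairs $(P,Q)$ and $(P',Q')$ of real quadratic forms in $\xi\in\mathbb{R}^3$ are equivalent if there exist invertible real matrices $M_1\in M_{3\times3}$ and $M_2\in M_{2\times2}$ such that $(P'(\xi),Q'(\xi))^T=M_2\cdot(P(M_1\xi),Q(M_1\xi))^T$ for every $\xi\in\mathbb{R}^3$. The extension operator associated with $S$ is $$E^Sf(x',x_4,x_5):=\int_{[-1,1]^3}f(\xi)\,e(\xi\cdot x'+P(\xi)x_4+Q(\xi)x_5)\,d\xi,$$ where $x'=(x_1,x_2,x_3)\in\mathbb{R}^3$, $x_4,x_5\in\mathbb{R}$, and $e(t)=e^{2\pi i t}$. Exponents $p,q$ are Lebesgue exponents in $[1,\infty]$ (with $q/(q-3)$ read as $1$ when $q=\infty$). *)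

(* Defs.v *)
From mathcomp Require Import all_boot all_order all_algebra.
From mathcomp Require Import complex.
From mathcomp Require Import all_classical all_reals all_analysis.

Set Implicit Arguments.
Unset Strict Implicit.
Unset Printing Implicit Defensive.

Import Order.TTheory GRing.Theory Num.Theory.
Import numFieldNormedType.Exports.

Local Open Scope classical_set_scope.
Local Open Scope ring_scope.

(* R^3 and R^5 as left-nested products of the Borel line, so that the Borel
   sigma-algebra and Lebesgue measure are the library's product structures. *)
Notation space3 R :=
  (measurableTypeR R * measurableTypeR R * measurableTypeR R)%type.
Notation space5 R :=
  (measurableTypeR R * measurableTypeR R * measurableTypeR R
   * measurableTypeR R * measurableTypeR R)%type.

Definition lebesgue3 (R : realType) : {measure set (space3 R) -> \bar R} :=
  ((@lebesgue_measure R \x @lebesgue_measure R) \x @lebesgue_measure R)%E.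

Definition lebesgue5 (R : realType) : {measure set (space5 R) -> \bar R} :=
  ((((@lebesgue_measure R \x @lebesgue_measure R) \x @lebesgue_measure R)
    \x @lebesgue_measure R) \x @lebesgue_measure R)%E.

Arguments lebesgue3 : clear implicits.
Arguments lebesgue5 : clear implicits.

Definition vec3 (R : realType) (x : space3 R) : 'cV[R]_3 :=
  \col_i [:: x.1.1; x.1.2; x.2]`_i.

Definition cube (R : realType) : set (space3 R) :=
  `[-1, 1] `*` `[-1, 1] `*` `[-1, 1].

Arguments cube : clear implicits.

Definition quadratic_form (R : realType) (P : 'cV[R]_3 -> R) : Prop :=
  exists A : 'M[R]_3, forall xi, P xi = (xi^T *m A *m xi) 0 0.

Definition pair_vec (R : realType) (a b : R) : 'cV[R]_2 :=
  \col_i [:: a; b]`_i.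

Definition equivalent_pairs (R : realType) (P Q P' Q' : 'cV[R]_3 -> R) : Prop :=
  exists (M1 : 'M[R]_3) (M2 : 'M[R]_2),
    [/\ M1 \in unitmx, M2 \in unitmx &
        forall xi, pair_vec (P' xi) (Q' xi) =
                   M2 *m pair_vec (P (M1 *m xi)) (Q (M1 *m xi))].

(* [xi 0 0], [xi 1 0], [xi 2 0] are the coordinates xi_1, xi_2, xi_3. *)
Definition equivalent_to_model_pair (R : realType) (P Q : 'cV[R]_3 -> R) : Prop :=
  [\/ equivalent_pairs P Q
        (fun xi => xi 0 0 ^+ 2 + xi 1 0 ^+ 2) (fun xi => xi 2 0 ^+ 2),
      equivalent_pairs P Q
        (fun xi => xi 0 0 ^+ 2 - xi 1 0 ^+ 2) (fun xi => xi 2 0 ^+ 2),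
      equivalent_pairs P Q
        (fun xi => xi 0 0 * xi 1 0 + xi 2 0 ^+ 2) (fun xi => xi 0 0 ^+ 2) |
      equivalent_pairs P Q
        (fun xi => xi 0 0 * xi 1 0) (fun xi => xi 0 0 * xi 2 0)].

(* e(t) = exp(2 pi i t) *)
Definition expi2pi (R : realType) (t : R) : R[i] :=
  (cos (2 * pi * t) +i* sin (2 * pi * t))%C.

Definition cintegral (R : realType) d (T : measurableType d)
    (mu : {measure set T -> \bar R}) (D : set T) (f : T -> R[i]) : R[i] :=
  (Rintegral mu D (fun x => complex.Re (f x)) +i*
   Rintegral mu D (fun x => complex.Im (f x)))%C.

Definition cmeasurable (R : realType) d (T : measurableType d) (f : T -> R[i])
    : Prop :=
  measurable_fun setT (fun x => complex.Re (f x)) /\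
  measurable_fun setT (fun x => complex.Im (f x)).

Definition cLnorm (R : realType) d (T : measurableType d)
    (mu : {measure set T -> \bar R}) (p : \bar R) (f : T -> R[i]) : \bar R :=
  Lnorm mu p (fun x => (Normc.normc (f x))%:E).

Definition extension (R : realType) (P Q : 'cV[R]_3 -> R)
    (f : space3 R -> R[i]) (x : space5 R) : R[i] :=
  let x' := x.1.1 in let x4 := x.1.2 in let x5 := x.2 in
  cintegral (lebesgue3 R) (cube R) (fun xi =>
    f xi * expi2pi (((vec3 xi)^T *m vec3 x') 0 0
                    + P (vec3 xi) * x4 + Q (vec3 xi) * x5)).

(* q/(q-3), read as 1 at q = +oo; only used for 4 <= q, so that neither the
   value at -oo nor that at 3 matters. *)
Definition critical_exponent (R : realType) (q : \bar R) : \bar R :=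
  match q with
  | q%:E => (q / (q - 3))%:E
  | _ => 1%:E
  end.

(* Main.v *)
From HB Require Import structures.
Require Import Defs.
From mathcomp Require Import all_boot all_order all_algebra.
From mathcomp Require Import complex.
From mathcomp Require Import all_classical all_reals all_analysis.
From mathcomp Require Import perm ess_sup_inf measurable_realfun ring lra.

Set Implicit Arguments.
Unset Strict Implicit.
Unset Printing Implicit Defensive.

Import Order.TTheory GRing.Theory Num.Theory.
Import numFieldNormedType.Exports.

Local Open Scope classical_set_scope.
Local Open Scope ring_scope.

(** The counterexamples are built from Knapp plates. For each of the four model
    pairs, one frequency variable (called eta_0, after a permutation in the
    first two models) can be confined to an interval of length about delta in
    such a way that the two forms together gain a factor delta^2: on
      |eta_0| <= delta, |eta_1| <= 1, |eta_2| <= 1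
    the first form is O(delta^e4) and the second O(delta^e5) with e4 + e5 = 2
    ([equivalent_to_model_pair_thin]). Translating the plate by a in the
    direction eta_0 changes a quadratic form only by an affine function, whose
    linear part can be absorbed in a linear change of the dual variable. Hence
    the phase is constant up to 1/8 when xi ranges over the plate and x over a
    set of measure about (1/delta) (1/delta^e4) (1/delta^e5) = delta^-3, and
    there |E 1_plate| is at least half of the measure of the plate, which is
    about delta ([phase_near_constant], [amplitude_indic_ge]). Raising to the
    power s and integrating, the integral of |E 1_plate|^s is at least a
    constant times delta^(s - 3).

    If q >= 4, one plate is enough: the estimate would give
      delta^(1 - 3/q) <= C delta^(1/p),
    which fails as delta tends to 0 when p < q/(q - 3)
    ([no_estimate_below_critical]).

    If q < 4, about 1/delta disjoint parallel plates are superposed. By the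
    pointwise Clarkson inequality
      |z + w|^s + |z - w|^s >= 2 (|z|^s + |w|^s)   (s >= 2)
    signs can be chosen one after the other so that the integrals of
    |E 1_plate|^s add up ([exists_signs]). The resulting f takes values in
    {-1, 0, 1} on the cube, so its L^p norm stays bounded for every p, while the
    integral of |Ef|^s is at least a constant times delta^(s - 4). Taking
    s = max(q, 2) < 4 and using the uniform bound on |Ef| to pass from s to q,
    this is a contradiction as delta tends to 0 ([no_estimate_below_4]).

    The measures of plates and of their dual sets, which are linear images of
    boxes, are controlled by a form of the uniqueness of Haar measure
    ([measure_pull_swap]); no determinant has to be computed. *)

(** * Linear images of measurable sets *)

Lemma measurable_preimageT d1 d2 (T1 : measurableType d1)
    (T2 : measurableType d2) (f : T1 -> T2) (B : set T2) :
  measurable_fun setT f -> measurable B -> measurable [set x | B (f x)].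
Proof.
by move=> mf mB; rewrite -[X in measurable X]setTI; exact: mf.
Qed.

(** What is used of Lebesgue measure on a product of lines, so that the same
    lemmas apply in dimensions 3 and 5. *)
Record linear_coordinates (R : realType) n d (T : measurableType d)
    (mu : {sigma_finite_measure set T -> \bar R})
    (v : T -> 'cV[R]_n) (w : 'cV[R]_n -> T) : Prop := LinearCoordinates {
  coordsK : cancel v w ;
  coordsKV : cancel w v ;
  measurable_coord : forall i, measurable_fun setT (fun x => v x i 0) ;
  measurable_of_coords : forall d' (S : measurableType d') (f : S -> 'cV[R]_n),
    (forall i, measurable_fun setT (fun s => f s i 0)) ->
    measurable_fun setT (fun s => w (f s)) ;
  measure_translate : forall t B, measurable B ->
    mu [set x | B (w (v x + t))] = mu B ;
  measure_box : forall r : 'I_n -> R, (forall i, 0 <= r i) ->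
    mu [set x | forall i, `|v x i 0| <= r i] = (\prod_i (2 * r i))%:E }.

Section LinearImage.
Context (R : realType) (n : nat) (d : measure_display) (T : measurableType d).
Context (mu : {sigma_finite_measure set T -> \bar R}).
Context (v : T -> 'cV[R]_n) (w : 'cV[R]_n -> T).
Hypothesis vw : linear_coordinates mu v w.

Let box (r : 'I_n -> R) : set T := [set x | forall i, `|v x i 0| <= r i].

Lemma measurable_box r : measurable (box r).
Proof.
rewrite /box (_ : [set x | _] = \bigcap_(i in [set` [set: 'I_n]%SET])
    [set x | `|v x i 0| <= r i]); last first.
  by apply/seteqP; split => x /= h i; [move=> _; exact: h|apply: h;
    rewrite /= inE].
apply: fin_bigcap_measurable => [|i _]; first exact: finite_finset.
apply: (measurable_preimageT (f := fun x =>
  v x i 0) (B := [set y | `|y| <= r i])).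
  exact: (measurable_coord vw).
rewrite (_ : [set y | _] = `[- r i, r i]%classic); first exact: measurable_itv.
by apply/seteqP; split => y /=; rewrite in_itv/= ler_norml.
Qed.

Lemma measurable_coord_mulmx d' (S : measurableType d') m (A : 'M[R]_(m, n))
    (f : S -> T) (i : 'I_m) : measurable_fun setT f ->
  measurable_fun setT (fun s => (A *m v (f s)) i 0).
Proof.
move=> mf; under eq_fun do rewrite mxE; apply: measurable_sum => j.
apply: measurable_funM; first exact: measurable_cst.
exact: (measurableT_comp (measurable_coord vw j)).
Qed.

Let pull (A : 'M[R]_n) (B : set T) : set T := [set x | B (w (A *m v x))].

Lemma measurable_mulmx (A : 'M[R]_n) :
  measurable_fun setT (fun x => w (A *m v x)).
Proof.
by apply: (measurable_of_coords vw) => i; exact: measurable_coord_mulmx.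
Qed.

Lemma measurable_pull A B : measurable B -> measurable (pull A B).
Proof. by move=> mB; apply: measurable_preimageT mB;
  exact: measurable_mulmx. Qed.

(** Uniqueness of Haar measure, in the form needed here: integrating
    1_C(Ax) 1_B(Ax + y) over y and then x gives mu(A^-1 C) mu(B), while the
    substitution x -> x - A^-1 y shows that the other order of integration gives
    mu(A^-1 B) mu(C), because C is symmetric. *)
Lemma measure_pull_swap (A : 'M[R]_n) (C B : set T) :
  A \in unitmx -> measurable C -> measurable B ->
  (forall x, C (w (- v x)) = C x) ->
  (mu (pull A C) * mu B = mu (pull A B) * mu C)%E.
Proof.
move=> uA mC mB symC.
have mv1 i : measurable_fun setT (fun p : T * T => (A *m v p.1) i 0).
  by apply: measurable_coord_mulmx; exact: measurable_fst.
have mv2 i : measurable_fun setT (fun p : T * T => v p.2 i 0).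
  exact: (measurableT_comp (measurable_coord vw i) measurable_snd).
have mCA (D : set T) : measurable D ->
    measurable [set p : T * T | D (w (A *m v p.1))].
  by apply: measurable_preimageT; exact: (measurable_of_coords vw).
have mAp (e : bool) (D : set T) : measurable D ->
    measurable [set p : T * T | D (w (A *m v p.1 + (-1) ^+ e *: v p.2))].
  apply: measurable_preimageT; apply: (measurable_of_coords vw) => i.
  under eq_fun do rewrite mxE [X in _ + X]mxE; apply: measurable_funD => //.
  by apply: measurable_funM => //; exact: measurable_cst.
pose E1 := [set p : T * T | C (w (A *m v p.1))] `&`
           [set p : T * T | B (w (A *m v p.1 + v p.2))].
pose E2 := [set p : T * T | B (w (A *m v p.1))] `&`
           [set p : T * T | C (w (A *m v p.1 - v p.2))].
have mE1 : measurable E1.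
  apply: measurableI; first exact: mCA.
  by have := mAp false _ mB; under eq_set do rewrite expr0 scale1r.
have mE2 : measurable E2.
  apply: measurableI; first exact: mCA.
  by have := mAp true _ mC; under eq_set do rewrite expr1 scaleN1r.
have slice (D : set T) (a : \bar R) (h : T -> \bar R) : measurable D ->
    (0 <= a)%E -> (forall x, D x -> h x = a) -> (forall x, ~ D x ->
      h x = 0%E) ->
    (\int[mu]_x h x = a * mu D)%E.
  move=> mD a0 hD hND; rewrite (eq_integral (fun x => a * (\1_D x)%:E)%E).
    rewrite ge0_integralZl ?integral_indic ?setIT//.
    by apply/measurable_EFinP; exact: measurable_indic.
  move=> x _; rewrite indicE; have [xD|xD] := boolP (x \in D).
    by rewrite mule1 hD//; apply/set_mem.
  by rewrite mule0 hND// => /mem_set; exact/negP.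
have tr (D : set T) t : measurable D ->
    mu [set y | D (w (t + v y))] = mu D.
  by move=> mD; under eq_set do rewrite addrC; exact: (measure_translate vw).
have I1 : (\int[mu]_x mu (xsection E1 x) = mu B * mu (pull A C))%E.
  apply: slice (measurable_pull A mC) (measure_ge0 _ _) _ _ => x Cx.
  - apply: etrans (tr B (A *m v x) mB); congr (mu _); apply/seteqP.
    split => y; rewrite /xsection/= inE /E1/=; [by case|by move=> By; split].
  - rewrite (_ : xsection _ _ = set0) ?measure0//; apply/seteqP.
    by split => y //=; rewrite /xsection/= inE => -[].
have I2 : (\int[mu]_x mu (xsection E2 x) = mu C * mu (pull A B))%E.
  apply: slice (measurable_pull A mB) (measure_ge0 _ _) _ _ => x Cx.
  - apply: etrans (tr C (- (A *m v x)) mC); congr (mu _); apply/seteqP.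
    split => y; rewrite /xsection/= inE /E2/=.
      by move=> [_]; rewrite -symC (coordsKV vw) opprB addrC.
    by move=> Cy; split => //; rewrite -symC (coordsKV vw) opprB addrC.
  - rewrite (_ : xsection _ _ = set0) ?measure0//; apply/seteqP.
    by split => y //=; rewrite /xsection/= inE => -[].
have E12 : (\int[mu]_x mu (xsection E1 x) = \int[mu]_x mu (xsection E2 x))%E.
  have := indic_fubini_tonelli mu mu mE1;
    have := indic_fubini_tonelli mu mu mE2.
  rewrite !indic_fubini_tonelli_FE// !indic_fubini_tonelli_GE//= => -> ->.
  apply: eq_integral => y _.
  rewrite -(measure_translate vw (- (invmx A *m v y))) /=; last first.
    exact: measurable_ysection.
  congr (mu _); apply/seteqP; split => x; rewrite /ysection/= !inE /E1 /E2/=;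
    rewrite (coordsKV vw) mulmxDr mulmxN mulKVmx// subrK; by case.
by rewrite muleC -I1 E12 I2 muleC.
Qed.

(** In [measure_pull_swap] take for C the unit cube: the image under A of the cube
    of half-width rho lies in C, so A^-1 C has at least the measure of that
    cube. Only the size of the entries enters, which makes the bound uniform over
    bounded families of matrices. *)
Lemma measure_pull_ge (A : 'M[R]_n) (B : set T) (rho : R) :
  A \in unitmx -> measurable B -> 0 <= rho ->
  (forall i, rho * \sum_j `|A i j| <= 1) ->
  ((rho ^+ n)%:E * mu B <= mu (pull A B))%E.
Proof.
move=> uA mB rho0 hA; pose C := box (fun=> 1).
have mC : measurable C by exact: measurable_box.
have muC : mu C = (2 ^+ n)%:E.
  by rewrite (measure_box vw)// mulr1 prodr_const card_ord.
have symC x : C (w (- v x)) = C x.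
  by apply/propext; split => + i => /(_ i); rewrite (coordsKV vw) mxE normrN.
have pullC : (((2 * rho) ^+ n)%:E <= mu (pull A C))%E.
  have -> : ((2 * rho) ^+ n)%:E = mu (box (fun=> rho)).
    by rewrite (measure_box vw)// prodr_const card_ord.
  apply: le_measure; rewrite ?inE;
    [exact: measurable_box|exact: measurable_pull|].
  move=> x hx i; rewrite (coordsKV vw) mxE (le_trans (ler_norm_sum _ _ _))//.
  apply: le_trans (hA i); rewrite mulr_sumr; apply: ler_sum => j _.
  by rewrite normrM mulrC ler_wpM2r// hx.
have := measure_pull_swap uA mC mB symC; rewrite muC => swap.
have : (((2 * rho) ^+ n)%:E * mu B <= mu (pull A B) * (2 ^+ n)%:E)%E.
  by rewrite -swap; apply: lee_wpmul2r => //; exact: measure_ge0.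
rewrite exprMn EFinM -muleA muleC lee_pmul2r// lte_fin exprn_gt0//.
Qed.

(** The lower bound [measure_pull_ge] for the inverse matrix. *)
Lemma measure_pull_le (A : 'M[R]_n) : A \in unitmx ->
  exists2 K : R, 0 < K &
    forall B, measurable B -> (mu (pull A B) <= K%:E * mu B)%E.
Proof.
move=> uA; pose s := 1 + \sum_i \sum_j `|invmx A i j|.
have s_gt0 : 0 < s.
  by rewrite ltr_pwDl// sumr_ge0// => i _; rewrite sumr_ge0.
exists (s ^+ n) => [|B mB]; first exact: exprn_gt0.
have pullK : pull (invmx A) (pull A B) = B.
  by rewrite /pull/= predeqE => x /=;
    rewrite (coordsKV vw) mulKVmx// (coordsK vw).
have := @measure_pull_ge (invmx A) (pull A B) s^-1.
rewrite pullK unitmx_inv => /(_ uA (measurable_pull _ mB)).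
rewrite invr_ge0 (ltW s_gt0) => /(_ isT) h.
have /h : forall i, s^-1 * \sum_j `|invmx A i j| <= 1.
  move=> i; rewrite mulrC ler_pdivrMr// mul1r.
  rewrite /s [X in 1 + X](bigD1 i)//= addrCA lerDl addr_ge0// sumr_ge0// => k _.
  by rewrite sumr_ge0.
move=> {}h; apply: le_trans (lee_wpmul2l _ h);
  last by rewrite lee_fin exprn_ge0// ltW.
by rewrite muleA -EFinM -exprMn mulfV ?gt_eqF// expr1n mul1e.
Qed.

End LinearImage.

Section RealLine.
Context (R : realType).

Lemma real_linear_coordinates :
  linear_coordinates (@lebesgue_measure R : {sigma_finite_measure set _ ->
    \bar R})
    (fun x : measurableTypeR R => const_mx x : 'cV[R]_1) (fun z => z 0 0).
Proof.
split => [x|z|i|d' S f mf|t B mB|r r0].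
- by rewrite mxE.
- by apply/matrixP => i j; rewrite !ord1 mxE.
- by under eq_fun do rewrite mxE; exact: measurable_id.
- exact: mf.
- have mt : measurable_fun setT
      (fun x : measurableTypeR R => x + t 0 0 : measurableTypeR R).
    by apply: measurable_funD; [exact: measurable_id|exact: measurable_cst].
  under eq_set do rewrite !mxE.
  rewrite -[LHS]/(pushforward lebesgue_measure
    (fun x : measurableTypeR R => x + t 0 0 : measurableTypeR R) B).
  apply/esym.
  apply: lebesgue_measure_unique mB => _ [[a b] _ <-]; rewrite /pushforward/=.
  transitivity (lebesgue_measure `]a - t 0 0, b - t 0 0]%classic).
    rewrite !lebesgue_measure_itv/= !lte_fin ltrD2r -!EFinB.
    by congr (if _ then _%:E else _); lra.
  congr (lebesgue_measure _).
  by apply/seteqP; split => x /=; rewrite !in_itv/= ltrBlDr lerBrDr.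
- rewrite (_ : [set x | _] = `[- r 0, r 0]%classic); last first.
    apply/seteqP; split => x /=; rewrite in_itv/= -ler_norml.
      by move=> /(_ 0); rewrite mxE.
    by move=> h i; rewrite mxE ord1.
  rewrite [LHS](lebesgue_measure_itv `[- r 0, r 0])/= big_ord1 lte_fin -EFinB
    opprK -mulr2n mulr_natl.
  case: ltP => // h; have : r 0 = 0 by have := r0 0; lra.
  by move=> ->; rewrite mul0rn.
Qed.

End RealLine.

Section ProductMeasure.
Context (R : realType) (d1 d2 : measure_display).
Context (T1 : measurableType d1) (T2 : measurableType d2).
Context (mu1 : {sigma_finite_measure set T1 -> \bar R}).
Context (mu2 : {sigma_finite_measure set T2 -> \bar R}).

(** The product measure under its own name, so that sigma-finiteness can be
    inferred for iterated products. *)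
Definition sfprod : set (T1 * T2) -> \bar R := (mu1 \x mu2)%E.

HB.instance Definition _ := Measure.on sfprod.

Let sigma_finite_sfprod : sigma_finite setT sfprod.
Proof.
have /sigma_finiteP[F [TF ndF finF]] := sigma_finiteT mu1.
have /sigma_finiteP[G [TG ndG finG]] := sigma_finiteT mu2.
exists (fun k => F k `*` G k); [|move=> k].
  apply/esym/seteqP; split => // -[x y] _.
  have [i _ Fx] : (\bigcup_i F i) x by rewrite -TF.
  have [j _ Gy] : (\bigcup_j G j) y by rewrite -TG.
  exists (maxn i j) => //; split.
    by move/subsetPset: (ndF _ _ (leq_maxl i j)); apply.
  by move/subsetPset: (ndG _ _ (leq_maxr i j)); apply.
have [[mF Foo] [mG Goo]] := (finF k, finG k); split; first exact: measurableX.
by rewrite /sfprod product_measure1E// lte_mul_pinfty// ge0_fin_numE.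
Qed.

HB.instance Definition _ :=
  Measure_isSigmaFinite.Build _ _ _ sfprod sigma_finite_sfprod.

End ProductMeasure.

Section Product.
Context (R : realType) (n1 n2 : nat) (d1 d2 : measure_display).
Context (T1 : measurableType d1) (T2 : measurableType d2).
Context (mu1 : {sigma_finite_measure set T1 -> \bar R}).
Context (mu2 : {sigma_finite_measure set T2 -> \bar R}).
Context (v1 : T1 -> 'cV[R]_n1) (w1 : 'cV[R]_n1 -> T1).
Context (v2 : T2 -> 'cV[R]_n2) (w2 : 'cV[R]_n2 -> T2).

Lemma prod_linear_coordinates :
  linear_coordinates mu1 v1 w1 -> linear_coordinates mu2 v2 w2 ->
  linear_coordinates (sfprod mu1 mu2)
    (fun p => col_mx (v1 p.1) (v2 p.2))
    (fun z => (w1 (usubmx z), w2 (dsubmx z))).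
Proof.
move=> vw1 vw2; split => [[x y]|z|i|d' S f mf|t B mB|r r0].
- by rewrite /= col_mxKu col_mxKd (coordsK vw1) (coordsK vw2).
- by rewrite /= (coordsKV vw1) (coordsKV vw2) vsubmxK.
- rewrite -(splitK i); case: (fintype.split i) => j /=.
    under eq_fun do rewrite col_mxEu.
    exact: (measurableT_comp (measurable_coord vw1 j) measurable_fst).
  under eq_fun do rewrite col_mxEd.
  exact: (measurableT_comp (measurable_coord vw2 j) measurable_snd).
- apply: measurable_fun_pair.
    by apply: (measurable_of_coords vw1) => i; under eq_fun do rewrite mxE;
      exact: mf.
  by apply: (measurable_of_coords vw2) => i; under eq_fun do rewrite mxE;
    exact: mf.
- rewrite -(vsubmxK t); set t1 := usubmx t; set t2 := dsubmx t.
  pose tau x := w1 (v1 x + t1).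
  have mtau : measurable_fun setT tau.
    apply: (measurable_of_coords vw1) => i; under eq_fun do rewrite mxE.
    by apply: measurable_funD;
      [exact: (measurable_coord vw1)|exact: measurable_cst].
  have mh := measurable_fun_xsection mu2 mB.
  rewrite /= /sfprod /product_measure1.
  transitivity (\int[mu1]_x ((mu2 \o xsection B) \o tau) x)%E.
    apply: eq_integral => x _ /=.
    rewrite -[RHS](measure_translate vw2 t2); last exact: measurable_xsection.
    congr (mu2 _); apply/seteqP; split => y; rewrite /xsection/= !inE/=;
      by rewrite add_col_mx col_mxKu col_mxKd.
  rewrite -[X in (\int[_]_(_ in X) _)%E](preimage_setT tau)
    -ge0_integral_pushforward//.
  by apply: eq_measure_integral => A mA _; exact: (measure_translate vw1).
- rewrite (_ : [set x | _] =
    [set x | forall i, `|v1 x i 0| <= r (lshift n2 i)] `*`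
    [set x | forall i, `|v2 x i 0| <= r (rshift n1 i)]); last first.
    apply/seteqP; split => -[x y] /= h.
      by split => i; [have := h (lshift n2 i)|have := h (rshift n1 i)];
        rewrite ?col_mxEu ?col_mxEd.
    move=> i; rewrite -(splitK i); case: (fintype.split i) => j /=.
      by rewrite col_mxEu; exact: h.1.
    by rewrite col_mxEd; exact: h.2.
  apply: etrans (product_measure1E mu1 mu2 (measurable_box vw1 _)
    (measurable_box vw2 _)) _.
  apply: etrans (congr2 *%E (measure_box vw1 _) (measure_box vw2 _)) _ => //.
  by rewrite -EFinM big_split_ord.
Qed.

End Product.

(** * Coordinates on the frequency space and on the dual space *)

Section Coordinates.
Context (R : realType).

Definition mu3 : {sigma_finite_measure set (space3 R) -> \bar R} :=
  sfprod (sfprod (@lebesgue_measure R) (@lebesgue_measure R))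
    (@lebesgue_measure R).

Definition mu5 : {sigma_finite_measure set (space5 R) -> \bar R} :=
  sfprod (sfprod mu3 (@lebesgue_measure R)) (@lebesgue_measure R).

Definition vec5 (x : space5 R) : 'cV[R]_(3 + 2) :=
  col_mx (vec3 x.1.1) (pair_vec x.1.2 x.2).

Lemma vec3_linear_coordinates :
  exists w, linear_coordinates mu3 (@vec3 R) w.
Proof.
have h := @real_linear_coordinates R.
have := prod_linear_coordinates (prod_linear_coordinates h h) h.
set v := fun p => _; set w := fun z => _ => vw; exists w.
suff -> : @vec3 R = v by [].
apply/funext => x; apply/matrixP => i j; rewrite ord1 /v !mxE.
case: splitP => k ik /=; rewrite ?mxE; last by rewrite ik ord1.
by case: splitP => l kl /=; rewrite ?mxE ik kl ord1.
Qed.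

Lemma vec5_linear_coordinates :
  exists w, linear_coordinates mu5 vec5 w.
Proof.
have h := @real_linear_coordinates R.
have [w3 h3] := vec3_linear_coordinates.
have := prod_linear_coordinates (prod_linear_coordinates h3 h) h.
set v := fun p => _; set w := fun z => _ => vw; exists w.
suff -> : vec5 = v by [].
apply/funext => x; apply/matrixP => i j; rewrite ord1 /v /vec5 mxE [RHS]mxE.
case: splitP => k ik /=; case: splitP => l il /=.
- rewrite [RHS]mxE; case: splitP => m lm /=.
    by congr (vec3 _ _ _); apply: val_inj; rewrite /= -ik il lm.
  by have := ltn_ord k; rewrite -ik il lm.
- by have := ltn_ord k; rewrite -ik il ord1.
- rewrite [RHS]mxE; case: splitP => m lm /=.
    by have := ltn_ord m; rewrite -lm -il ik.
  rewrite !mxE; have -> // : k = 0 :> nat.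
  by have := etrans (esym ik) (etrans il lm); rewrite ord1 => /eqP;
    rewrite (eqn_add2l 3 k 0) => /eqP.
- rewrite !mxE; have -> // : k = 1 :> nat.
  by have := etrans (esym ik) il; rewrite ord1 => /eqP;
    rewrite (eqn_add2l 3 k 1) => /eqP.
Qed.

End Coordinates.

(** * Plates and dual plates *)

Section Strips.
Context (R : realType).

(** A plate of half-width delta around eta_0 = a, where xi = M eta. *)
Definition strip (M : 'M[R]_3) (a r delta : R) : set (space3 R) :=
  [set xi | forall i, `|(invmx M *m vec3 xi - a *: delta_mx 0 0) i 0| <=
                      if i == 0 then delta else r].

Lemma cubeE (xi : space3 R) :
  (forall i, `|vec3 xi i 0| <= 1) -> cube R xi.
Proof.
move=> h; split => [|/=]; first split => /=.
- by have := h 0; rewrite mxE ler_norml in_itv.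
- by have := h 1; rewrite mxE ler_norml in_itv.
- by have := h 2; rewrite mxE ler_norml in_itv.
Qed.

Lemma strip_in_cube (M : 'M[R]_3) : M \in unitmx ->
  exists2 r : R, 0 < r <= 1 & forall a delta, `|a| + delta <= r ->
    strip M a r delta `<=` cube R.
Proof.
move=> uM; pose s := 1 + \sum_i \sum_j `|M i j|.
have sum_ge0 i : 0 <= \sum_j `|M i j| by rewrite sumr_ge0.
have s_ge1 : 1 <= s by rewrite lerDl sumr_ge0.
have s_gt0 : 0 < s by exact: lt_le_trans s_ge1.
exists s^-1 => [|a delta ad xi hxi].
  by rewrite invr_gt0 s_gt0 invf_le1.
apply: cubeE => i; rewrite -(mulKVmx uM (vec3 xi)).
set eta := invmx M *m vec3 xi.
have eta_le j : `|eta j 0| <= s^-1.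
  have := hxi j; rewrite -/eta !mxE; case: eqVneq => [->|_] /=; last first.
    by rewrite mulr0 subr0.
  rewrite mulr1 => h; apply: le_trans ad; rewrite -lerBlDl; apply: le_trans h.
  exact: lerB_dist.
rewrite mxE (le_trans (ler_norm_sum _ _ _))//.
apply: (@le_trans _ _ (\sum_j `|M i j| * s^-1)).
  by apply: ler_sum => j _; rewrite normrM ler_wpM2l.
rewrite -mulr_suml ler_pdivrMr// mul1r /s [X in 1 + X](bigD1 i)//=.
by rewrite addrCA lerDl addr_ge0// sumr_ge0.
Qed.

Lemma measurable_strip M a r delta : measurable (strip M a r delta).
Proof.
have [w vw] := @vec3_linear_coordinates R.
rewrite (_ : strip _ _ _ _ = [set x | [set y | forall i, `|vec3 y i 0| <=
    if i == 0 then delta else r] (w (invmx M *m vec3 x - a *: delta_mx 0 0))]).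
  apply: measurable_preimageT; last exact: (measurable_box vw).
  apply: (measurable_of_coords vw) => i; under eq_fun do rewrite mxE.
  apply: measurable_funD; last exact: measurable_cst.
  by apply: (measurable_coord_mulmx vw); exact: measurable_id.
by apply/seteqP; split => x h i; have := h i; rewrite (coordsKV vw).
Qed.

Lemma measure_strip (M : 'M[R]_3) (r : R) : M \in unitmx -> 0 < r ->
  exists c K : R, [/\ 0 < c, 0 < K & forall a delta, 0 < delta ->
    ((c * delta)%:E <= mu3 R (strip M a r delta) <= (K * delta)%:E)%E].
Proof.
move=> uM r0; have [w vw] := @vec3_linear_coordinates R.
have uM' : invmx M \in unitmx by rewrite unitmx_inv.
have [K K0 leK] := measure_pull_le vw uM'.
pose s := 1 + \sum_i \sum_j `|invmx M i j|.
have sum_ge0 i : 0 <= \sum_j `|invmx M i j| by rewrite sumr_ge0.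
have s_gt0 : 0 < s by rewrite ltr_pwDl// sumr_ge0.
pose b := 8 * r ^+ 2; have b_gt0 : 0 < b by rewrite mulr_gt0// exprn_gt0.
exists (s^-1 ^+ 3 * b), (K * b); split.
- by rewrite mulr_gt0// exprn_gt0// invr_gt0.
- by rewrite mulr_gt0.
move=> a delta delta0.
pose B0 := [set y : space3 R | forall i, `|vec3 y i 0| <= if i == 0 then delta
  else r].
pose B := [set x | B0 (w (vec3 x + - (a *: delta_mx 0 0)))].
have mB0 : measurable B0 by exact: (measurable_box vw).
have mB : measurable B.
  apply: measurable_preimageT mB0; apply: (measurable_of_coords vw) => i.
  under eq_fun do rewrite mxE; apply: measurable_funD;
    last exact: measurable_cst.
  exact: (measurable_coord vw).
have muB : mu3 R B = (b * delta)%:E.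
  apply: etrans (measure_translate vw _ mB0) _.
  apply: etrans (measure_box vw _) _ => [i|].
    by case: ifP => _; exact: ltW.
  by rewrite !big_ord_recl big_ord0 /=; congr (_%:E); rewrite /b; ring.
have -> : strip M a r delta = [set x | B (w (invmx M *m vec3 x))].
  by apply/seteqP; split => x h i; have := h i; rewrite !(coordsKV vw).
apply/andP; split.
  rewrite -mulrA EFinM -muB; apply: (measure_pull_ge vw) => //.
    by rewrite invr_ge0 ltW.
  move=> i; rewrite mulrC ler_pdivrMr// mul1r /s [X in 1 + X](bigD1 i)//=.
  by rewrite addrCA lerDl addr_ge0// sumr_ge0.
by rewrite -mulrA EFinM -muB; exact: leK.
Qed.

(** The plate around eta_0 = a has phase nearly constant here when the columns
    of B are the linear parts that the two forms acquire by translation along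
    eta_0; the shear by a * B follows the translation of the plate. *)
Definition dual_plate (M : 'M[R]_3) (N : 'M[R]_2) (B : 'M[R]_(3, 2))
    (a kappa delta : R) (e4 e5 : nat) : set (space5 R) :=
  [set x | let y := N *m pair_vec x.1.2 x.2 in
    [/\ forall i, `|(M *m vec3 x.1.1 + a *: (B *m y)) i 0| <=
                  kappa / (if i == 0 then delta else 1),
        `|y 0 0| <= kappa / delta ^+ e4 & `|y 1 0| <= kappa / delta ^+ e5]].

(** The linear map that defines the dual plate is block triangular and affine in
    a, so its entries are bounded uniformly for a in [0, 1]; the box has sides
    1/delta, 1, 1, 1/delta^e4 and 1/delta^e5 up to constants. *)
Lemma measure_dual_plate M N B (kappa : R) :
  M \in unitmx -> N \in unitmx -> 0 < kappa ->
  exists2 c : R, 0 < c & forall a delta e4 e5,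
    0 <= a <= 1 -> 0 < delta -> (e4 + e5 = 2)%N ->
    measurable (dual_plate M N B a kappa delta e4 e5) /\
    ((c / delta ^+ 3)%:E <= mu5 R (dual_plate M N B a kappa delta e4 e5))%E.
Proof.
move=> uM uN k0; have [w vw] := @vec5_linear_coordinates R.
pose A a := block_mx M (a *: (B *m N)) 0 N.
pose A0 := block_mx M 0 0 N.
pose A1 := block_mx 0 (B *m N) 0 0 : 'M[R]_(3 + 2).
have AE a : A a = A0 + a *: A1.
  by rewrite /A /A0 /A1 scale_block_mx add_block_mx !scaler0 !addr0 add0r.
have uA a : A a \in unitmx.
  by rewrite unitmxE det_ublock unitrM -!unitmxE uM.
pose s := 1 + \sum_i (\sum_j `|A0 i j| + \sum_j `|A1 i j|).
have sum_ge0 i : 0 <= \sum_j `|A0 i j| + \sum_j `|A1 i j|.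
  by rewrite addr_ge0// sumr_ge0.
have s_gt0 : 0 < s by rewrite ltr_pwDl// sumr_ge0.
exists (s^-1 ^+ 5 * (2 * kappa) ^+ 5).
  by rewrite mulr_gt0// exprn_gt0// ?invr_gt0// mulr_gt0.
move=> a delta e4 e5 /andP[a0 a1] delta0 e45.
pose r (i : 'I_(3 + 2)) := match fintype.split i with
  | inl k => kappa / (if k == 0 then delta else 1)
  | inr k => kappa / delta ^+ (if k == 0 then e4 else e5) end.
pose box := [set x | forall i, `|vec5 x i 0| <= r i].
have mbox : measurable box by exact: (measurable_box vw).
have -> : dual_plate M N B a kappa delta e4 e5 =
    [set x | box (w (A a *m vec5 x))].
  apply/seteqP; split => x; rewrite /dual_plate /box/= (coordsKV vw);
    rewrite /A /vec5 mul_block_col mul0mx add0r -scalemxAl -mulmxA.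
  - move=> [h1 h2 h3] i; rewrite /r mxE; case: fintype.split => k;
    first exact: h1.
    case: eqVneq => [->//|]; case: k => -[|[|]]// hk _.
    by rewrite (_ : Ordinal hk = 1)//; exact: val_inj.
  - move=> h; split => [i||].
    + have := h (lshift 2 i); rewrite col_mxEu /r.
      by rewrite (unsplitK (inl i)).
    + have := h (rshift 3 0); rewrite col_mxEd /r.
      by rewrite (unsplitK (inr 0)).
    + have := h (rshift 3 1); rewrite col_mxEd /r.
      by rewrite (unsplitK (inr 1)).
split; first exact: (measurable_pull vw).
have mubox : mu5 R box = ((2 * kappa) ^+ 5 / delta ^+ 3)%:E.
  apply: etrans (measure_box vw _) _ => [i|].
    rewrite /r; case: fintype.split => k; rewrite divr_ge0 ?(ltW k0)//.
      by case: ifP => // _; exact: ltW.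
    by rewrite exprn_ge0// ltW.
  rewrite big_split_ord /=; congr (_%:E).
  under eq_bigr do rewrite /r (unsplitK (inl _)).
  under [X in _ * X]eq_bigr do rewrite /r (unsplitK (inr _)).
  rewrite !big_ord_recl !big_ord0 /=.
  have -> : delta ^+ 3 = delta * (delta ^+ e4 * delta ^+ e5).
    by rewrite -exprD e45 -exprS.
  by field; rewrite !expf_neq0 ?gt_eqF.
rewrite -mulrA EFinM -mubox; apply: (measure_pull_ge vw) => //.
  by rewrite invr_ge0 ltW.
move=> i; rewrite mulrC ler_pdivrMr// mul1r.
apply: (@le_trans _ _ (\sum_j `|A0 i j| + \sum_j `|A1 i j|)).
  rewrite -big_split/=; apply: ler_sum => j _; rewrite AE mxE [X in _ + X]mxE.
  rewrite (le_trans (ler_normD _ _))// lerD2l normrM ger0_norm//.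
  by rewrite ler_piMl.
rewrite /s [X in 1 + X](bigD1 i)//=.
by rewrite addrCA lerDl addr_ge0// sumr_ge0.
Qed.

End Strips.

(** * Quadratic forms on thin plates *)

Section Phase.
Context (R : realType).
Implicit Types (P Q : 'cV[R]_3 -> R) (u z : 'cV[R]_3).

Local Notation dot u z := ((u^T *m z) 0 0).

Definition phase P Q (xi : space3 R) (x : space5 R) : R :=
  dot (vec3 xi) (vec3 x.1.1) + P (vec3 xi) * x.1.2 + Q (vec3 xi) * x.2.

(** The Galilean symmetry of a quadratic form. *)
Lemma quadratic_form_shift P (e : 'cV[R]_3) : quadratic_form P ->
  exists b : 'cV[R]_3, forall a z,
    P (z + a *: e) = P z + a * dot z b + a ^+ 2 * P e.
Proof.
move=> [S PS]; exists ((S + S^T) *m e) => a z; rewrite !PS.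
have -> : dot z ((S + S^T) *m e) = (z^T *m S *m e) 0 0 + (e^T *m S *m z) 0 0.
  rewrite mulmxDl mulmxDr mxE !mulmxA; congr (_ + _).
  have -> : (e^T *m S *m z) 0 0 = (e^T *m S *m z)^T 0 0 by rewrite [RHS]mxE.
  by rewrite !trmx_mul trmxK mulmxA.
have -> : (z + a *: e)^T = z^T + a *: e^T by rewrite linearD /= linearZ.
rewrite !mulmxDl !mulmxDr -!scalemxAl -!scalemxAr.
by rewrite !mxE; ring.
Qed.

Lemma equivalent_pairs_quadratic_form P Q P' Q' :
  quadratic_form P -> quadratic_form Q -> equivalent_pairs P Q P' Q' ->
  quadratic_form P' /\ quadratic_form Q'.
Proof.
move=> [S PS] [S' QS] [M [N [_ _ PQ]]].
have form c d : quadratic_form (fun xi => c * P (M *m xi) + d * Q (M *m xi)).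
  exists (c *: (M^T *m S *m M) + d *: (M^T *m S' *m M)) => xi.
  rewrite PS QS !trmx_mul mulmxDr mulmxDl -!scalemxAr -!scalemxAl !mulmxA.
  by rewrite !mxE; ring.
have eqE i xi : pair_vec (P' xi) (Q' xi) i 0 =
    N i 0 * P (M *m xi) + N i 1 * Q (M *m xi).
  rewrite PQ mxE !big_ord_recl big_ord0 addr0 !mxE /=.
  by congr (_ + N i _ * _); exact: val_inj.
split.
- have [T TE] := form (N 0 0) (N 0 1); exists T => xi.
  by rewrite -TE -eqE mxE.
- have [T TE] := form (N 1 0) (N 1 1); exists T => xi.
  by rewrite -TE -eqE mxE.
Qed.

(** Both forms are small on the plate around eta_0 = 0; the total gain delta^2
    determines the size of the dual plate. *)
Definition thin_pair P Q := exists e4 e5, (e4 + e5 = 2)%N /\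
  forall delta z, 0 < delta <= 1 ->
    (forall i, `|z i 0| <= if i == 0 then delta else 1) ->
    `|P z| <= 2 * delta ^+ e4 /\ `|Q z| <= 2 * delta ^+ e5.

(** The thin direction is the third one for the first two models, where a
    transposition moves it to the front, and the first one for the last two. *)
Lemma equivalent_to_model_pair_thin P Q : equivalent_to_model_pair P Q ->
  exists P' Q', equivalent_pairs P Q P' Q' /\ thin_pair P' Q'.
Proof.
have coord delta z : (forall i, `|z i 0| <= if i == 0 then delta else 1) ->
    [/\ `|z 0 0| <= delta, `|z 1 0| <= 1 & `|z 2 0| <= 1 :> R].
  by move=> h; split; [have := h 0|have := h 1|have := h 2].
have swap P' Q' : equivalent_pairs P Q P' Q' ->
    equivalent_pairs P Q
      (fun xi => P' (row_perm (tperm 0 2) xi))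
      (fun xi => Q' (row_perm (tperm 0 2) xi)).
  move=> [M [N [uM uN PQ]]]; exists (M *m perm_mx (tperm 0 2)), N.
  split => // [|xi]; first by rewrite unitmx_mul uM unitmx_perm.
  by rewrite PQ !row_permE !mulmxA.
have sqr_le (s t : R) : `|s| <= t -> `|s ^+ 2| <= t ^+ 2.
  by move=> st; rewrite normrX lerXn2r// nnegrE// (le_trans _ st).
have mul_le (s t s' t' : R) : `|s| <= s' -> `|t| <= t' -> `|s * t| <= s' * t'.
  by move=> ? ?; rewrite normrM ler_pM.
have sum_le (s t c : R) : `|s| <= c -> `|t| <= c -> `|s + t| <= 2 * c.
  by move=> sc tc;
    rewrite (le_trans (ler_normD _ _))// mulr2n mulrDl mul1r lerD.
case=> [/swap|/swap||] => h; [| | |]; do 2 eexists; (split; first exact: h).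
- exists 0%N, 2%N; split=> // delta z /andP[d0 d1] /coord[z0 z1 z2].
  rewrite !mxE tpermL tpermR tpermD//; split.
    by rewrite expr0; apply: sum_le; rewrite -[leRHS](expr1n _ 2);
      exact: sqr_le.
  by rewrite (le_trans (sqr_le _ _ z0))// ler_peMl// ?exprn_ge0 ?ltW// ltr1n.
- exists 0%N, 2%N; split=> // delta z /andP[d0 d1] /coord[z0 z1 z2].
  rewrite !mxE tpermL tpermR tpermD//; split.
    rewrite expr0; apply: sum_le; rewrite ?normrN -[leRHS](expr1n _ 2);
      exact: sqr_le.
  by rewrite (le_trans (sqr_le _ _ z0))// ler_peMl// ?exprn_ge0 ?ltW// ltr1n.
- exists 0%N, 2%N; split=> // delta z /andP[d0 d1] /coord[z0 z1 z2]; split.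
    rewrite expr0; apply: sum_le; last first.
      by rewrite -[leRHS](expr1n _ 2); exact: sqr_le.
    by rewrite -[leRHS]mul1r; apply: mul_le => //; exact: le_trans d1.
  by rewrite (le_trans (sqr_le _ _ z0))// ler_peMl// ?exprn_ge0 ?ltW// ltr1n.
- exists 1%N, 1%N; split=> // delta z /andP[d0 d1] /coord[z0 z1 z2].
  have le2 : delta * 1 <= 2 * delta ^+ 1 by rewrite expr1; lra.
  by split; apply: le_trans le2; exact: mul_le.
Qed.

(** Writing eta = z + a e_0, the phase is theta(x) plus a linear form in z,
    whose coefficients are the first three coordinates of the dual plate, plus the two
    forms at z times the last two coordinates. The three groups contribute at
    most 3 kappa, 2 kappa and 2 kappa. *)
Lemma phase_near_constant P Q : quadratic_form P -> quadratic_form Q ->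
  equivalent_to_model_pair P Q ->
  exists (M : 'M[R]_3) (M' : 'M[R]_3) (N : 'M[R]_2) (B : 'M[R]_(3, 2)) (e4 e5 :
    nat),
  [/\ M \in unitmx, M' \in unitmx, N \in unitmx, (e4 + e5 = 2)%N &
  forall a, exists theta : space5 R -> R, forall r delta kappa xi x,
    0 < delta <= 1 -> r <= 1 -> 0 < kappa ->
    strip M a r delta xi -> dual_plate M' N B a kappa delta e4 e5 x ->
    `|phase P Q xi x - theta x| <= 7 * kappa].
Proof.
move=> qP qQ /equivalent_to_model_pair_thin[P' [Q' [eqPQ [e4 [e5 [e45
  thin]]]]]].
have [qP' qQ'] := equivalent_pairs_quadratic_form qP qQ eqPQ.
pose e : 'cV[R]_3 := delta_mx 0 0.
have [b4 P'D] := quadratic_form_shift e qP'.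
have [b5 Q'D] := quadratic_form_shift e qQ'.
have [M [N [uM uN PQ]]] := eqPQ.
exists M, M^T, (invmx N)^T, (row_mx b4 b5 : 'M[R]_(3, 1 + 1)), e4, e5.
split => //; rewrite ?unitmx_tr ?unitmx_inv// => a.
pose Y (x : space5 R) := (invmx N)^T *m pair_vec x.1.2 x.2.
exists (fun x => a * (M^T *m vec3 x.1.1) 0 0 +
  a ^+ 2 * (P' e * Y x 0 0 + Q' e * Y x 1 0)).
move=> r delta kappa xi x d01 r1 k0 hxi; set y := Y x => -[].
rewrite -/(Y x) -/y; set Z := (_ + _) => hZ hy4 hy5.
set eta := invmx M *m vec3 xi; pose z := eta - a *: e.
have etaE : eta = z + a *: e by rewrite subrK.
have xiE : vec3 xi = M *m eta by rewrite mulKVmx.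
have hz i : `|z i 0| <= if i == 0 then delta else 1.
  by apply: le_trans (hxi i) _; case: ifP.
have [hP hQ] := thin delta z d01 hz.
have forms : P (vec3 xi) * x.1.2 + Q (vec3 xi) * x.2 =
    P' eta * y 0 0 + Q' eta * y 1 0.
  have dot2 (s t : R) (q : 'cV[R]_2) :
      ((pair_vec s t)^T *m q) 0 0 = s * q 0 0 + t * q 1 0.
    rewrite mxE !big_ord_recl big_ord0 addr0 !mxE /=.
    by congr (_ * q _ _ + _ * q _ _); exact: val_inj.
  transitivity (((pair_vec (P (vec3 xi)) (Q (vec3 xi)))^T *m
      pair_vec x.1.2 x.2) 0 0); first by rewrite dot2 !mxE.
  rewrite -dot2 PQ -xiE trmx_mul /y /Y -mulmxA [N^T *m _]mulmxA -trmx_mul.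
  by rewrite mulVmx// trmx1 mul1mx.
have linear_part : dot (vec3 xi) (vec3 x.1.1) =
    dot z (M^T *m vec3 x.1.1) + a * (M^T *m vec3 x.1.1) 0 0.
  rewrite xiE trmx_mul -mulmxA etaE.
  have -> : (z + a *: e)^T = z^T + a *: e^T by rewrite linearD /= linearZ.
  rewrite mulmxDl mxE.
  congr (_ + _); rewrite -scalemxAl mxE; congr (_ * _).
  by rewrite trmx_delta -rowE mxE.
have ZE : dot z Z = dot z (M^T *m vec3 x.1.1) +
    a * (dot z b4 * y 0 0 + dot z b5 * y 1 0).
  rewrite /Z mulmxDr mxE; congr (_ + _); rewrite -scalemxAr mxE; congr (_ * _).
  rewrite mulmxA.
  have -> : z^T *m (row_mx b4 b5 : 'M[R]_(3, 1 + 1)) =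
      row_mx (z^T *m b4) (z^T *m b5) by exact: mul_mx_row.
  rewrite mxE !big_ord_recl big_ord0 addr0.
  have l0 := row_mxEl (z^T *m b4) (z^T *m b5) 0 0.
  have r0 := row_mxEr (z^T *m b4) (z^T *m b5) 0 0.
  congr (_ * y _ 0 + _ * y _ 0); last exact: val_inj.
    by rewrite -l0; congr (row_mx _ _ _ _); exact: val_inj.
  by rewrite -r0; congr (row_mx _ _ _ _); exact: val_inj.
have -> : phase P Q xi x - (a * (M^T *m vec3 x.1.1) 0 0 +
    a ^+ 2 * (P' e * y 0 0 + Q' e * y 1 0)) =
    dot z Z + P' z * y 0 0 + Q' z * y 1 0.
  rewrite /phase -(addrA (dot _ _)) forms linear_part ZE etaE P'D Q'D; ring.
have [d0 d1] := andP d01.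
have prod_le (s t c s' : R) : 0 < s' -> `|s| <= c * s' -> `|t| <= kappa / s' ->
    `|s * t| <= c * kappa.
  move=> s'0 hs ht; rewrite normrM; apply: le_trans (ler_pM _ _ hs ht) _ => //.
  by rewrite (_ : c * s' * (kappa / s') = c * kappa)//; field; rewrite gt_eqF.
have hzZ i : `|z i 0 * Z i 0| <= kappa.
  rewrite -[leRHS]mul1r; apply: prod_le (hZ i); rewrite ?mul1r//.
  by case: ifP.
have hPy : `|P' z * y 0 0| <= 2 * kappa.
  by apply: prod_le hP hy4; exact: exprn_gt0.
have hQy : `|Q' z * y 1 0| <= 2 * kappa.
  by apply: prod_le hQ hy5; exact: exprn_gt0.
have hdot : `|dot z Z| <= 3 * kappa.
  rewrite mxE (le_trans (ler_norm_sum _ _ _))//.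
  rewrite [leRHS](_ : _ = \sum_(i < 3) kappa); last first.
    by rewrite sumr_const card_ord mulr_natl.
  by apply: ler_sum => i _; rewrite mxE.
rewrite (le_trans (ler_normD _ _))// (_ : 7 * kappa = 3 * kappa + 2 * kappa + 2
  * kappa); last by ring.
by rewrite lerD// (le_trans (ler_normD _ _))// lerD.
Qed.

(** n parallel plates of half-width r / (3 n) centred at r j / n: the gaps make
    them disjoint, and r is small enough for all of them to lie in the cube. *)
Lemma knapp_plates P Q : quadratic_form P -> quadratic_form Q ->
  equivalent_to_model_pair P Q ->
  exists c K : R, [/\ 0 < c, 0 < K & forall n, (0 < n)%N ->
  exists (D : nat -> set (space3 R)) (T : nat -> set (space5 R))
         (theta : nat -> space5 R -> R),
    (forall i j, (i < j)%N -> D i `&` D j = set0) /\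
    forall j, (j < n)%N -> [/\ measurable (D j), D j `<=` cube R,
      ((c / n%:R)%:E <= mu3 R (D j) <= (K / n%:R)%:E)%E,
      measurable (T j) /\ ((c * n%:R ^+ 3)%:E <= mu5 R (T j))%E &
      forall x xi, T j x -> D j xi ->
        `|phase P Q xi x - theta j x| <= 8^-1]].
Proof.
move=> qP qQ hPQ.
have [M [M' [N [B [e4 [e5 [uM uM' uN e45 near]]]]]]] :=
  phase_near_constant qP qQ hPQ.
have [r /andP[r0 r1] sub_cube] := strip_in_cube uM.
have [c1 [K1 [c1_gt0 K1_gt0 mu_strip]]] := measure_strip uM r0.
(* 7 * kappa = 1/8 *)
pose kappa : R := 56^-1.
have kappa0 : 0 < kappa by rewrite invr_gt0.
have [c2 c2_gt0 mu_plate] := measure_dual_plate B uM' uN kappa0.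
pose c := Num.min (c1 * r / 3) (c2 * 27 / r ^+ 3).
have [cl cr] : c <= c1 * r / 3 /\ c <= c2 * 27 / r ^+ 3.
  by split; rewrite ge_min lexx ?orbT.
exists c, (K1 * r / 3); split.
- by rewrite lt_min !divr_gt0// ?mulr_gt0// exprn_gt0.
- by rewrite divr_gt0// mulr_gt0.
move=> n n0; have nR0 : 0 < n%:R :> R by rewrite ltr0n.
have nR1 : 1 <= n%:R :> R by rewrite ler1n.
pose delta : R := r / (3 * n%:R).
have delta0 : 0 < delta by rewrite divr_gt0// mulr_gt0.
have delta1 : delta <= 1 by rewrite ler_pdivrMr ?mulr_gt0// mul1r; lra.
pose a j : R := r * j%:R / n%:R.
have aS i j : (i < j)%N -> a i + 3 * delta <= a j.
  move=> ij; have -> : a i + 3 * delta = r * i.+1%:R / n%:R.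
    by rewrite /a /delta -natr1; field; rewrite gt_eqF.
  by rewrite ler_pM2r ?invr_gt0// ler_pM2l// ler_nat.
have /choice[theta hth] : forall j, exists theta : space5 R -> R,
    forall r delta kappa xi x, 0 < delta <= 1 -> r <= 1 -> 0 < kappa ->
    strip M (a j) r delta xi -> dual_plate M' N B (a j) kappa delta e4 e5 x ->
    `|phase P Q xi x - theta x| <= 7 * kappa by move=> j; exact: near.
exists (fun j => strip M (a j) r delta),
  (fun j => dual_plate M' N B (a j) kappa delta e4 e5), theta; split.
  move=> i j ij; apply/seteqP; split => // xi [/= /(_ 0) + /(_ 0)].
  rewrite mxE [in X in _ -> X -> _]mxE !mxE/= !mulr1 !ler_norml.
  by move=> /andP[_ h1] /andP[h2 _]; have := aS _ _ ij; lra.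
move=> j jn.
have a0 k : 0 <= a k by rewrite divr_ge0// mulr_ge0// ltW.
have aj : a j + 3 * delta <= r.
  by rewrite (le_trans (aS j n jn))// /a mulfK ?gt_eqF.
have /andP[mul muu] := mu_strip (a j) delta delta0.
have a01 : 0 <= a j <= 1 by rewrite a0/=; lra.
have [mT muT] := mu_plate (a j) delta e4 e5 a01 delta0 e45.
split.
- exact: measurable_strip.
- by apply: sub_cube; rewrite ger0_norm//; lra.
- apply/andP; split.
    apply: le_trans mul; rewrite lee_fin ler_pdivrMr//.
    apply: le_trans cl _; rewrite /delta le_eqVlt; apply/orP; left; apply/eqP.
    by field; rewrite gt_eqF.
  apply: le_trans muu _; rewrite lee_fin /delta le_eqVlt; apply/orP; left.
  by apply/eqP; field; rewrite gt_eqF.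
- split => //; apply: le_trans muT; rewrite lee_fin.
  have -> : c2 / delta ^+ 3 = c2 * 27 / r ^+ 3 * n%:R ^+ 3.
    by rewrite /delta; field; rewrite !gt_eqF.
  by rewrite ler_pM2r// exprn_gt0.
- move=> x xi Tx Dxi; have -> : 8^-1 = 7 * kappa by rewrite /kappa; lra.
  by apply: hth Dxi Tx => //; rewrite delta0.
Qed.

End Phase.

(** * Oscillatory integrals *)

Section ScalarInequalities.
Context (R : realType).

Lemma powR_superadd (u v t : R) : 0 <= u -> 0 <= v -> 1 <= t ->
  u `^ t + v `^ t <= (u + v) `^ t.
Proof.
move=> u0 v0 t1; have t0 : 0 < t by exact: lt_le_trans t1.
have uv0 := addr_ge0 u0 v0.
have step w : 0 <= w -> w <= u + v -> w `^ t <= w * (u + v) `^ (t - 1).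
  move=> w0 wuv; rewrite -(mulr_powRB1 w0 t0) ler_wpM2l//.
  by rewrite ge0_ler_powR// subr_ge0.
rewrite -(mulr_powRB1 uv0 t0) mulrDl lerD//; apply: step => //;
  first by rewrite lerDl.
by rewrite lerDr.
Qed.

Lemma powR_midpoint (a b t : R) : 0 <= a -> 0 <= b -> 1 <= t ->
  2 * ((a + b) / 2) `^ t <= a `^ t + b `^ t.
Proof.
move=> a0 b0 t1.
have : (2^-1 * a + (1 - 2^-1) * b) `^ t <= 2^-1 * a `^ t + (1 - 2^-1) * b `^ t.
  apply: (convex_powR t1 (Itv01 _ _)); rewrite ?inE/= ?in_itv/= ?andbT//.
  by rewrite invf_le1// ler1n.
have -> : 2^-1 * a + (1 - 2^-1) * b = (a + b) / 2 by lra.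
lra.
Qed.

(** The Clarkson inequality in terms of squared moduli: a and b stand for
    |z + w|^2 and |z - w|^2, u and v for |z|^2 and |w|^2, so that the hypothesis
    on a + b is the parallelogram law; t is half of the exponent. *)
Lemma clarkson_powR (a b u v t : R) : 0 <= a -> 0 <= b -> 0 <= u -> 0 <= v ->
  1 <= t -> a + b = 2 * (u + v) -> 2 * (u `^ t + v `^ t) <= a `^ t + b `^ t.
Proof.
move=> a0 b0 u0 v0 t1 abuv; apply: le_trans (powR_midpoint a0 b0 t1).
have -> : (a + b) / 2 = u + v by rewrite abuv mulrC mulKf.
by rewrite ler_pM2l// powR_superadd.
Qed.

Lemma cos_ge_half (y : R) : `|y| <= pi / 4 -> 2^-1 <= cos y.
Proof.
have pi0 := pi_gt0 R; rewrite ler_norml => /andP[y1 y2].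
have c0 : 0 <= cos y by apply: cos_ge0_pihalf; apply/andP; split; lra.
have : 0 <= cos (y *+ 2).
  by apply: cos_ge0_pihalf; rewrite (mulr2n y); apply/andP; split; lra.
rewrite cos_mulr2n (mulr2n (cos y ^+ 2)) expr2 => c2; rewrite leNgt;
  apply/negP => clt.
have : cos y * cos y <= cos y * 2^-1 by rewrite ler_wpM2l// ltW.
lra.
Qed.

End ScalarInequalities.

Section OscillatoryIntegral.
Context (R : realType) (d1 d2 : measure_display).
Context (X : measurableType d1) (Y : measurableType d2).
Context (mu : {sigma_finite_measure set X -> \bar R}).
Context (D : set X) (phi : X -> Y -> R).
Hypothesis mD : measurable D.
Hypothesis finD : (mu D < +oo)%E.
Hypothesis mphi : measurable_fun setT (fun p : Y * X => phi p.2 p.1).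

Definition admissible (f : X -> R) :=
  measurable_fun setT f /\ forall x, `|f x| <= 1.

Lemma admissible_indic (S : set X) : measurable S -> admissible \1_S.
Proof.
move=> mS; split => [|x]; first exact: measurable_indic.
by rewrite indicE; case: (_ \in _); rewrite ?normr1 ?normr0.
Qed.

Definition wave (h : R -> R) := measurable_fun setT h /\ forall t, `|h t| <= 1.

Lemma wave_cos : wave (@cos R).
Proof.
split=> [|t]; last by rewrite ler_norml cos_geN1 cos_le1.
by apply: continuous_measurable_fun; exact: continuous_cos.
Qed.

Lemma wave_sin : wave (@sin R).
Proof.
split=> [|t]; last by rewrite ler_norml sin_geN1 sin_le1.
by apply: continuous_measurable_fun; exact: continuous_sin.
Qed.

Definition oscint (h : R -> R) (f : X -> R) (y : Y) : R :=
  \int[mu]_(x in D) (f x * h (2 * pi * phi x y)).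

(** The modulus of the complex integral of f e(phi). *)
Definition amplitude (f : X -> R) (y : Y) : R :=
  Num.sqrt (oscint cos f y ^+ 2 + oscint sin f y ^+ 2).

Lemma integrable_of_bound (g : X -> R) (b : R) :
  measurable_fun setT g -> (forall x, `|g x| <= b) ->
  mu.-integrable D (EFin \o g).
Proof.
move=> mg gb; apply: measurable_bounded_integrable => //.
  exact: measurable_funTS.
exists b; split; first exact: num_real.
by move=> c bc x _ /=; rewrite (le_trans (gb x))// ltW.
Qed.

Lemma measurable_wave_phase h y : wave h ->
  measurable_fun setT (fun x => h (2 * pi * phi x y)).
Proof.
move=> [mh _]; apply: (measurableT_comp mh).
apply: measurable_funM; first exact: measurable_cst.
exact: (measurableT_comp mphi (measurable_fun_pair (measurable_cst y)
  (@measurable_id _ _ setT))).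
Qed.

Lemma integrable_oscint h f y : wave h -> admissible f ->
  mu.-integrable D (EFin \o (fun x => f x * h (2 * pi * phi x y))).
Proof.
move=> wh [mf f1]; apply: (@integrable_of_bound _ 1).
  by apply: measurable_funM => //; exact: measurable_wave_phase.
by move=> x; rewrite normrM mulr_ile1 ?wh.2.
Qed.

Lemma oscint_le h f y : wave h -> admissible f ->
  `|oscint h f y| <= fine (mu D).
Proof.
move=> wh af; have ig := integrable_oscint y wh af.
rewrite (le_trans (le_normr_Rintegral _ ig))// -[leRHS]mul1r -Rintegral_cst//.
apply: le_Rintegral => //.
- exact: (integrable_norm ig).
- by apply: (@integrable_of_bound _ 1) => [|x];
  [exact: measurable_cst|rewrite normr1].
- by move=> x _; rewrite normrM mulr_ile1 ?wh.2 ?af.2.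
Qed.

Lemma amplitude_ge0 f y : 0 <= amplitude f y.
Proof. exact: sqrtr_ge0. Qed.

Lemma sqr_amplitude f y :
  amplitude f y ^+ 2 = oscint cos f y ^+ 2 + oscint sin f y ^+ 2.
Proof. by rewrite sqr_sqrtr// addr_ge0// sqr_ge0. Qed.

Lemma amplitude_le f y : admissible f -> amplitude f y <= 2 * fine (mu D).
Proof.
move=> af; have M0 : 0 <= fine (mu D) by rewrite fine_ge0.
rewrite -(ler_pXn2r (ltn0Sn 1)) ?nnegrE ?amplitude_ge0 ?mulr_ge0//
  sqr_amplitude.
have := oscint_le y wave_cos af; have := oscint_le y wave_sin af.
rewrite !ler_norml => /andP[? ?] /andP[? ?]; nra.
Qed.

(** The integrand plus 1 is nonnegative, so that measurability of the partial
    integral is part of Tonelli's theorem. *)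
Lemma measurable_oscint h f : wave h -> admissible f ->
  measurable_fun setT (oscint h f).
Proof.
move=> wh af; have [mf f1] := af.
pose F (p : Y * X) : R := \1_D p.2 * (f p.2 * h (2 * pi * phi p.2 p.1) + 1).
have F0 p : (0 <= (F p)%:E)%E.
  rewrite lee_fin mulr_ge0// -lerBlDr sub0r.
  have : `|f p.2 * h (2 * pi * phi p.2 p.1)| <= 1 by rewrite normrM mulr_ile1
    ?wh.2.
  by rewrite ler_norml => /andP[].
have mF : measurable_fun setT (EFin \o F).
  apply/measurable_EFinP; apply: measurable_funM.
    by apply: measurableT_comp measurable_snd; exact: measurable_indic.
  apply: measurable_funD; last exact: measurable_cst.
  apply: measurable_funM; first by apply: measurableT_comp measurable_snd.
  apply: (measurableT_comp wh.1); apply: measurable_funM => //.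
have -> : oscint h f = (fun y =>
  fine (fubini_F mu (EFin \o F) y) - fine (mu D)).
  apply/funext => y; rewrite /fubini_F /=.
  have -> : (\int[mu]_x (F (y, x))%:E)%E =
      (\int[mu]_(x in D) (f x * h (2 * pi * phi x y) + 1)%:E)%E.
    rewrite [RHS]integral_mkcond; apply: eq_integral => x _.
    by rewrite patchE /F /= indicE; case: ifPn => xD; rewrite ?mul1r ?mul0r.
  rewrite -/(Rintegral mu D _) RintegralD//; last 2 first.
  - exact: integrable_oscint.
  - by apply: (@integrable_of_bound _ 1) => [|x];
    [exact: measurable_cst|rewrite normr1].
  by rewrite Rintegral_cst// mul1r addrK.
apply: measurable_funB; last exact: measurable_cst.
apply: (measurableT_comp (f := fine)) => //.
exact: measurable_fun_fubini_tonelli_F.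
Qed.

Lemma measurable_amplitude f : admissible f ->
  measurable_fun setT (amplitude f).
Proof.
move=> af; rewrite (_ : amplitude f = Num.sqrt \o
  (fun y => oscint cos f y ^+ 2 + oscint sin f y ^+ 2)) //.
apply: measurableT_comp.
  by apply: continuous_measurable_fun; exact: sqrt_continuous.
by apply: measurable_funD; apply: measurable_funX; apply: measurable_oscint;
  rewrite //; [exact: wave_cos|exact: wave_sin].
Qed.

Lemma oscint_addN (e : bool) h f g y : wave h -> admissible f -> admissible g ->
  oscint h (fun x => f x + (-1) ^+ e * g x) y =
  oscint h f y + (-1) ^+ e * oscint h g y.
Proof.
move=> wh af ag; rewrite /oscint -RintegralZl//; last exact: integrable_oscint.
rewrite -RintegralD//; last 2 first.
- exact: integrable_oscint.
- exact: (integrableZl mD ((-1) ^+ e) (integrable_oscint y wh ag)).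
by apply: eq_Rintegral => x _; rewrite mulrDl mulrA.
Qed.

Lemma amplitude_clarkson f g y (s : R) : admissible f -> admissible g ->
  2 <= s ->
  2 * (amplitude f y `^ s + amplitude g y `^ s) <=
  amplitude (fun x => f x + g x) y `^ s + amplitude (fun x => f x - g x) y `^ s.
Proof.
move=> af ag s2.
have sE a : 0 <= a -> a `^ s = (a ^+ 2) `^ (s / 2).
  by move=> a0; rewrite -powR_mulrn// -powRrM mulrCA mulfV ?mulr1.
have addE h : wave h -> oscint h (fun x =>
  f x + g x) y = oscint h f y + oscint h g y.
  move=> wh; have := oscint_addN false y wh af ag.
  by rewrite expr0 mul1r => <-; congr oscint; apply/funext => x; rewrite mul1r.
have subE h : wave h -> oscint h (fun x =>
  f x - g x) y = oscint h f y - oscint h g y.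
  move=> wh; have := oscint_addN true y wh af ag.
  by rewrite expr1 mulN1r => <-; congr oscint; apply/funext => x;
    rewrite mulN1r.
rewrite !sE ?amplitude_ge0//; apply: clarkson_powR; rewrite ?sqr_ge0//;
  first by lra.
rewrite !sqr_amplitude !addE ?subE; try exact: wave_cos; try exact: wave_sin.
by ring.
Qed.

(** After rotation by the constant phase theta the integrand has real part at
    least cos(pi / 4) >= 1/2 on S, so there is no cancellation. *)
Lemma amplitude_indic_ge (S : set X) y theta : measurable S -> S `<=` D ->
  (forall x, S x -> `|phi x y - theta| <= 8^-1) ->
  fine (mu S) / 2 <= amplitude \1_S y.
Proof.
move=> mS SD near.
have aS := admissible_indic mS.
set c := cos (2 * pi * theta); set s := sin (2 * pi * theta).
have cs : c ^+ 2 + s ^+ 2 = 1 by rewrite cos2Dsin2.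
have lb : fine (mu S) / 2 <= c * oscint cos \1_S y + s * oscint sin \1_S y.
  have icos := integrable_oscint y wave_cos aS.
  have isin := integrable_oscint y wave_sin aS.
  rewrite /oscint -!RintegralZl// -RintegralD//; last 2 first.
  - exact: (integrableZl mD c icos).
  - exact: (integrableZl mD s isin).
  have -> : fine (mu S) / 2 = \int[mu]_(x in D) (2^-1 * \1_S x).
    rewrite RintegralZl//; last exact: (integrable_of_bound aS.1 aS.2).
    by rewrite mulrC /Rintegral integral_indic// setIidl.
  apply: le_Rintegral => //.
  - exact: (integrableZl mD 2^-1 (integrable_of_bound aS.1 aS.2)).
  - exact: (integrableD mD (integrableZl mD c icos) (integrableZl mD s isin)).
  move=> x _; rewrite indicE; have [xS|xS] := boolP (x \in S); last first.
    by rewrite !(mul0r, mulr0) addr0.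
  rewrite !mul1r mulr1 /c /s -cosB -mulrBr; apply: cos_ge_half.
  have pi0 := pi_gt0 R.
  rewrite normrM ger0_norm ?mulr_ge0 ?(ltW pi0)//.
  have := near x (set_mem xS); rewrite distrC => h; nra.
apply: le_trans lb _; set a := oscint cos _ _; set b := oscint sin _ _.
rewrite (le_trans (ler_norm _))// -(ler_pXn2r (ltn0Sn 1)) ?nnegrE
  ?amplitude_ge0//.
rewrite sqr_amplitude -/a -/b real_normK ?num_real//.
have := sqr_ge0 (c * b - s * a); nra.
Qed.

End OscillatoryIntegral.

(** * Superposition of plates with signs *)

Lemma ge0_integral_clarkson (R : realType) d (Y : measurableType d)
    (nu : {measure set Y -> \bar R}) (f g h k : Y -> R) :
  (forall y, 0 <= f y) -> (forall y, 0 <= g y) ->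
  measurable_fun setT f -> measurable_fun setT g ->
  measurable_fun setT h -> measurable_fun setT k ->
  (forall y, 2 * (f y + g y) <= h y + k y) ->
  (forall y, 0 <= h y) -> (forall y, 0 <= k y) ->
  (2%:E * (\int[nu]_y (f y)%:E + \int[nu]_y (g y)%:E) <=
   \int[nu]_y (h y)%:E + \int[nu]_y (k y)%:E)%E.
Proof.
move=> f0 g0 mf mg mh mk fghk h0 k0.
have mE F : measurable_fun setT F -> measurable_fun setT (EFin \o F : Y ->
  \bar R).
  by move=> mF; apply/measurable_EFinP.
rewrite -!ge0_integralD//; try exact: mE.
  rewrite -ge0_integralZl_EFin//.
  - apply: ge0_le_integral => //.
    + by move=> y _; rewrite mule_ge0// adde_ge0// lee_fin.
    + by apply: measurable_funeM; apply: emeasurable_funD; exact: mE.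
    + by apply: emeasurable_funD; exact: mE.
    + by move=> y _; rewrite -!EFinD -EFinM lee_fin.
  - by move=> y _; rewrite adde_ge0// lee_fin.
  - by apply: emeasurable_funD; exact: mE.
all: by move=> y _; rewrite lee_fin.
Qed.

Lemma lee_add_half (R : realType) (a : R) (x y : \bar R) :
  ((2 * a)%:E <= x + y)%E -> (a%:E <= x)%E \/ (a%:E <= y)%E.
Proof.
move=> axy; have [ax|xa] := leP a%:E x; first by left.
right; rewrite leNgt; apply/negP => ya; move: axy; apply/negP; rewrite -ltNge.
by have := lteD xa ya; rewrite -EFinD -mulr2n mulr_natl.
Qed.

(** Adding the sets one at a time: by the Clarkson inequality one of f + 1_S and
    f - 1_S has at least the energy of f plus that of 1_S. Disjointness keeps
    the values of f in {-1, 0, 1}. *)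
Lemma exists_signs (R : realType) d (X : measurableType d)
    (E : (X -> R) -> \bar R) (S : nat -> set X) (n : nat) (L : R) :
  (forall f, (0 <= E f)%E) ->
  (forall f g, admissible f -> admissible g ->
    admissible (fun x => f x + g x) -> admissible (fun x => f x - g x) ->
    (2%:E * (E f + E g) <=
      E (fun x => f x + g x)%R + E (fun x => f x - g x)%R)%E) ->
  (forall i j, (i < j)%N -> S i `&` S j = set0) ->
  (forall j, (j < n)%N -> measurable (S j) /\ (L%:E <= E \1_(S j))%E) ->
  exists f, [/\ admissible f,
    forall x, f x != 0 -> exists2 j, (j < n)%N & S j x &
    ((n%:R * L)%:E <= E f)%E].
Proof.
move=> E0 E_clarkson disj hS; have : (n <= n)%N by [].
elim: {-2}n => [_|m IH mn].
  exists (fun=> 0); split; last by rewrite mul0r.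
    by split => [|x]; [exact: measurable_cst|rewrite normr0].
  by move=> x; rewrite eqxx.
have [f [af suppf Ef]] := IH (ltnW mn); have [mS ES] := hS m mn.
have ag : admissible (\1_(S m) : X -> R) := admissible_indic R mS.
have f0 x : S m x -> f x = 0.
  move=> Sx; apply/eqP/negPn/negP => /suppf[j jm Sjx].
  by have : (S j `&` S m) x by []; rewrite disj.
have g0 x : ~ S m x -> \1_(S m) x = 0 :> R.
  by move=> Sx; rewrite indicE memNset.
have sum_le x (e : R) : `|e| = 1 -> `|f x + e * \1_(S m) x| <= 1.
  move=> e1; have [Sx|Sx] := pselect (S m x).
    by rewrite f0// add0r normrM e1 mul1r ag.2.
  by rewrite g0// mulr0 addr0 af.2.
have afDg : admissible (fun x => f x + \1_(S m) x).
  split => [|x]; first exact: measurable_funD af.1 ag.1.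
  by have := sum_le x 1; rewrite normr1 mul1r; exact.
have afBg : admissible (fun x => f x - \1_(S m) x).
  split => [|x]; first exact: measurable_funB af.1 ag.1.
  by have := sum_le x (-1); rewrite normrN1 mulN1r; exact.
have add_plate h : admissible h -> (forall x, ~ S m x -> h x = f x) ->
    ((m.+1%:R * L)%:E <= E h)%E ->
    exists f, [/\ admissible f,
      forall x, f x != 0 -> exists2 j, (j < m.+1)%N & S j x &
      ((m.+1%:R * L)%:E <= E f)%E].
  move=> ah hf Eh; exists h; split; [exact: ah| |exact: Eh] => x.
  have [Sx _|Sx] := pselect (S m x); first by exists m.
  by rewrite hf// => /suppf[j jm Sjx]; exists j => //; exact: ltnW.
have clark := E_clarkson _ _ af ag afDg afBg.
have total : ((2 * (m.+1%:R * L))%:E <=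
    2%:E * (E f + E \1_(S m)))%E.
  have -> : 2 * (m.+1%:R * L) = 2 * (m%:R * L + L) by rewrite -natr1; ring.
  by rewrite EFinM lee_pmul2l// EFinD leeD.
have [hD|hB] := lee_add_half (le_trans total clark).
  by apply: (add_plate _ afDg _ hD) => x Sx; rewrite g0// addr0.
by apply: (add_plate _ afBg _ hB) => x Sx; rewrite g0// subr0.
Qed.

Section Signs.
Context (R : realType) (d1 d2 : measure_display).
Context (X : measurableType d1) (Y : measurableType d2).
Context (mu : {sigma_finite_measure set X -> \bar R}).
Context (nu : {measure set Y -> \bar R}).
Context (D : set X) (phi : X -> Y -> R).
Hypothesis mD : measurable D.
Hypothesis finD : (mu D < +oo)%E.
Hypothesis mphi : measurable_fun setT (fun p : Y * X => phi p.2 p.1).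

Local Notation amp := (amplitude mu D phi).

Definition energy (s : R) (f : X -> R) : \bar R :=
  (\int[nu]_y (amp f y `^ s)%:E)%E.

Let measurable_density s f : admissible f ->
  measurable_fun setT (fun y => amp f y `^ s).
Proof.
move=> af; apply: (measurableT_comp (measurable_powR s)).
exact: measurable_amplitude.
Qed.

Let measurable_energy s f : admissible f ->
  measurable_fun setT (fun y => (amp f y `^ s)%:E).
Proof. by move=> af; apply/measurable_EFinP; exact: measurable_density. Qed.

Let density_ge0 s f y : (0 <= (amp f y `^ s)%:E)%E.
Proof. by rewrite lee_fin powR_ge0. Qed.

Lemma energy_ge0 s f : (0 <= energy s f)%E.
Proof. by apply: integral_ge0 => y _; exact: density_ge0. Qed.

Lemma energy_clarkson s f g : 2 <= s -> admissible f -> admissible g ->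
  admissible (fun x => f x + g x) -> admissible (fun x => f x - g x) ->
  (2%:E * (energy s f + energy s g) <=
   energy s (fun x => f x + g x)%R + energy s (fun x => f x - g x)%R)%E.
Proof.
move=> s2 af ag afDg afBg; apply: ge0_integral_clarkson.
- by move=> y; exact: powR_ge0.
- by move=> y; exact: powR_ge0.
- exact: measurable_density af.
- exact: measurable_density ag.
- exact: measurable_density afDg.
- exact: measurable_density afBg.
- by move=> y; exact: amplitude_clarkson.
- by move=> y; exact: powR_ge0.
- by move=> y; exact: powR_ge0.
Qed.

Lemma energy_indic_ge (S : set X) (T : set Y) (theta : Y -> R) (m t s : R) :
  0 <= s -> 0 <= m -> measurable S -> S `<=` D -> (m%:E <= mu S)%E ->
  measurable T -> (t%:E <= nu T)%E ->
  (forall y x, T y -> S x -> `|phi x y - theta y| <= 8^-1) ->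
  (((m / 2) `^ s * t)%:E <= energy s \1_S)%E.
Proof.
move=> s0 m0 mS SD muS mT nuT near.
have finS : mu S \is a fin_num.
  rewrite ge0_fin_numE//; apply: le_lt_trans finD.
  by apply: le_measure => //; rewrite inE.
have aS := admissible_indic R mS.
apply: (@le_trans _ _ (\int[nu]_y (((m / 2) `^ s)%:E * (\1_T y)%:E))%E).
  rewrite ge0_integralZl_EFin//; last exact: powR_ge0.
    by rewrite integral_indic// setIT EFinM lee_wpmul2l// lee_fin powR_ge0.
  by apply/measurable_EFinP; exact: measurable_indic.
apply: ge0_le_integral => //.
- by move=> y _; rewrite -EFinM lee_fin mulr_ge0// powR_ge0.
- by apply: measurable_funeM; apply/measurable_EFinP; exact: measurable_indic.
- exact: measurable_energy.
move=> y _; rewrite -EFinM lee_fin indicE; have [yT|yT] := boolP (y \in T).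
  rewrite mulr1 ge0_ler_powR ?nnegrE ?amplitude_ge0 ?divr_ge0//.
  have := @amplitude_indic_ge _ _ _ _ _ mu D phi mD finD mphi S y (theta y) mS
    SD
    (fun x Sx => near y x (set_mem yT) Sx).
  apply: le_trans; rewrite ler_pM2r ?invr_gt0//.
  by rewrite -lee_fin fineK.
by rewrite mulr0 powR_ge0.
Qed.

(** The amplitude is at most twice the measure of D, and s >= q. *)
Lemma energy_le_energy f (q s : R) : admissible f -> 0 < q -> q <= s ->
  (energy s f <= ((2 * fine (mu D)) `^ (s - q))%:E * energy q f)%E.
Proof.
move=> af q0 qs; rewrite /energy -ge0_integralZl_EFin; last 4 first.
- exact: measurableT.
- by move=> y _; exact: density_ge0.
- exact: measurable_energy.
- exact: powR_ge0.
apply: ge0_le_integral; first exact: measurableT.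
- by move=> y _; exact: density_ge0.
- exact: measurable_energy.
- by apply: measurable_funeM; exact: measurable_energy.
move=> y _; rewrite -EFinM lee_fin.
have ub : amp f y <= 2 * fine (mu D) by exact: amplitude_le.
have -> : amp f y `^ s = amp f y `^ (s - q) * amp f y `^ q.
  rewrite -powRD ?subrK//; apply/implyP; rewrite gt_eqF//.
  exact: lt_le_trans qs.
by rewrite ler_wpM2r ?powR_ge0// ge0_ler_powR ?subr_ge0 ?nnegrE ?amplitude_ge0
  ?mulr_ge0 ?fine_ge0.
Qed.

End Signs.

(** * The restriction estimate on plates *)

(** [mu3] and [mu5] agree with [lebesgue3] and [lebesgue5]; going through one
    product at a time keeps the conversions short. *)
Lemma sfprodE (R : realType) d1 d2 (T1 : measurableType d1) (T2 :
  measurableType d2)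
    (m1 : {measure set T1 -> \bar R}) (mu1 : {sigma_finite_measure set T1 ->
      \bar R})
    (mu2 : {sigma_finite_measure set T2 -> \bar R}) :
  (forall A, measurable A -> m1 A = mu1 A) ->
  forall A, (m1 \x mu2)%E A = sfprod mu1 mu2 A.
Proof.
move=> m1E A; apply: eq_measure_integral => B mB _; exact: m1E.
Qed.

Lemma lebesgue3E (R : realType) A : lebesgue3 R A = mu3 R A.
Proof. by apply: sfprodE => {}A mA; apply: sfprodE. Qed.

Lemma lebesgue5E (R : realType) A : lebesgue5 R A = mu5 R A.
Proof. apply: sfprodE => {}A mA; apply: sfprodE => {}A {}mA;
  exact: lebesgue3E. Qed.

Lemma integral_lebesgue5 (R : realType) (g : space5 R -> \bar R) :
  (\int[lebesgue5 R]_x g x = \int[mu5 R]_x g x)%E.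
Proof. by apply: eq_measure_integral => A _ _; rewrite lebesgue5E. Qed.

Lemma integral_lebesgue3 (R : realType) D (g : space3 R -> \bar R) :
  (\int[lebesgue3 R]_(x in D) g x = \int[mu3 R]_(x in D) g x)%E.
Proof. by apply: eq_measure_integral => A _ _; rewrite lebesgue3E. Qed.

Section Extension.
Context (R : realType) (P Q : 'cV[R]_3 -> R).
Hypotheses (qP : quadratic_form P) (qQ : quadratic_form Q).

Lemma measurable_vec3 d (T : measurableType d) (f : T -> space3 R) i :
  measurable_fun setT f -> measurable_fun setT (fun t => vec3 (f t) i 0).
Proof.
move=> mf; have [w vw] := @vec3_linear_coordinates R.
exact: (measurableT_comp (measurable_coord vw i)).
Qed.

Lemma measurable_quadratic_form (F : 'cV[R]_3 -> R) : quadratic_form F ->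
  measurable_fun setT (fun xi : space3 R => F (vec3 xi)).
Proof.
move=> [S FS]; have [w vw] := @vec3_linear_coordinates R.
under eq_fun do rewrite FS -mulmxA mxE.
apply: measurable_sum => i; apply: measurable_funM.
  by under eq_fun do rewrite mxE; exact: (measurable_coord vw).
exact: (measurable_coord_mulmx vw).
Qed.

Lemma measurable_phase :
  measurable_fun setT (fun p : space5 R * space3 R => phase P Q p.2 p.1).
Proof.
have m1 : measurable_fun setT (fun p : space5 R * space3 R => p.1).
  exact: measurable_fst.
have mF F : quadratic_form F ->
    measurable_fun setT (fun p : space5 R * space3 R => F (vec3 p.2)).
  by move=> qF; apply: (measurableT_comp (measurable_quadratic_form qF));
    exact: measurable_snd.
apply: measurable_funD; last first.
  by apply: measurable_funM;
    [exact: mF|exact: measurableT_comp measurable_snd m1].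
apply: measurable_funD; last first.
  apply: measurable_funM; first exact: mF.
  exact: measurableT_comp measurable_snd (measurableT_comp measurable_fst m1).
under eq_fun do rewrite mxE.
apply: measurable_sum => i; apply: measurable_funM.
  by under eq_fun do rewrite mxE; exact: measurable_vec3 measurable_snd.
apply: measurable_vec3.
exact: measurableT_comp measurable_fst (measurableT_comp measurable_fst m1).
Qed.

Lemma measurable_cube : measurable (cube R).
Proof. by apply: measurableX => //; apply: measurableX. Qed.

Lemma mu3_cube : mu3 R (cube R) = 8%:E.
Proof.
have [w vw] := @vec3_linear_coordinates R.
have -> : cube R = [set x | forall i, `|vec3 x i 0| <= 1].
  apply/seteqP; split => x; last exact: cubeE.
  move=> [[/= + +] +]; rewrite !in_itv/= -!ler_norml => h0 h1 h2 i.
  by rewrite mxE; case: i => -[|[|[|]]].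
apply: etrans (measure_box vw _) _ => //.
by rewrite prodr_const card_ord mulr1; congr (_%:E); ring.
Qed.

Lemma normc_extension (f : space3 R -> R) x :
  Normc.normc (extension P Q (fun xi => (f xi)%:C%C) x) =
  amplitude (mu3 R) (cube R) (phase P Q) f x.
Proof.
have muE (g : space3 R -> R) : Rintegral (lebesgue3 R) (cube R) g =
    Rintegral (mu3 R) (cube R) g.
  by congr fine; exact: integral_lebesgue3.
pose z xi := (f xi)%:C%C * expi2pi (phase P Q xi x).
have reE : Rintegral (lebesgue3 R) (cube R) (fun xi => complex.Re (z xi)) =
    oscint (mu3 R) (cube R) (phase P Q) cos f x.
  by rewrite muE; apply: eq_Rintegral => xi _; rewrite /z /= mul0r subr0.
have imE : Rintegral (lebesgue3 R) (cube R) (fun xi => complex.Im (z xi)) =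
    oscint (mu3 R) (cube R) (phase P Q) sin f x.
  by rewrite muE; apply: eq_Rintegral => xi _; rewrite /z /= mul0r addr0.
by rewrite /amplitude -reE -imE.
Qed.

(** For p >= 1, the L^p norm of the indicator of a set of measure m > 0. *)
Definition support_norm (p : \bar R) (m : R) : R :=
  if p is r%:E then m `^ r^-1 else 1.

Lemma cLnorm_le_support (p : \bar R) (S : set (space3 R)) (f : space3 R -> R) :
  (1 <= p)%E -> measurable S -> (mu3 R S < +oo)%E -> admissible f ->
  (forall x, f x != 0 -> S x) ->
  (cLnorm (lebesgue3 R) p (fun xi => (f xi)%:C%C) <=
    (support_norm p (fine (mu3 R S)))%:E)%E.
Proof.
move=> p1 mS finS [mf f1] suppf.
have normf x : Normc.normc (f x)%:C%C = `|f x|.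
  by rewrite /= expr0n addr0 sqrtr_sqr.
rewrite /cLnorm unlock; case: p p1 => [r r1|_|//]; last first.
  case: ifPn => // _; apply/ess_supP; apply/nearW => x.
  change (`|(Normc.normc (f x)%:C%C)%:E| <= 1)%E.
  by rewrite normf abse_EFin lee_fin normr_id.
have r0 : 0 < r by rewrite (lt_le_trans ltr01).
rewrite /support_norm -poweR_EFin fineK ?ge0_fin_numE//.
apply: gt0_ler_poweR.
- by rewrite invr_ge0 ltW.
- rewrite in_itv; apply/andP; split; last exact: leey.
  by apply: integral_ge0 => x _; exact: poweR_ge0.
- by rewrite in_itv; apply/andP; split; [exact: measure_ge0|exact: leey].
rewrite integral_lebesgue3.
have -> : mu3 R S = (\int[mu3 R]_x (\1_S x)%:E)%E.
  by rewrite integral_indic// setIT.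
apply: ge0_le_integral => //.
- by move=> x _; exact: poweR_ge0.
- apply: (measurableT_comp (measurable_poweR r));
  apply: measurableT_comp => //; apply/measurable_EFinP.
  by under eq_fun do rewrite normf; exact: measurableT_comp.
- by apply/measurable_EFinP; exact: measurable_indic.
move=> x _; rewrite normf indicE; have [xS|xS] := boolP (x \in S).
  rewrite abse_EFin normr_id poweR_EFin lee_fin.
  apply: (@le_trans _ _ (1 `^ r)); last by rewrite powR1.
  by rewrite ge0_ler_powR ?nnegrE ?(ltW r0).
have -> : f x = 0.
  by apply/eqP/negPn/negP => /suppf /mem_set; exact/negP.
by rewrite normr0 abse0 poweR0r ?gt_eqF.
Qed.

Definition extension_estimate (p q : \bar R) (C : R) :=
  forall f : space3 R -> R[i], cmeasurable f ->
    (cLnorm (lebesgue3 R) p f < +oo)%E ->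
    (cLnorm (lebesgue5 R) q (extension P Q f) <=
      C%:E * cLnorm (lebesgue3 R) p f)%E.

(** What the extension estimate says about a function of modulus at most 1 that
    is supported in S. *)
Lemma energy_le_support (p : \bar R) (q C a : R) (S : set (space3 R))
    (f : space3 R -> R) : (1 <= p)%E -> 0 < q -> extension_estimate p q%:E C ->
  measurable S -> (mu3 R S < +oo)%E -> admissible f ->
  (forall x, f x != 0 -> S x) ->
  (a%:E <= energy (mu3 R) (mu5 R) (cube R) (phase P Q) q f)%E ->
  a <= (`|C| * support_norm p (fine (mu3 R S))) `^ q.
Proof.
move=> p1 q0 est mS finS af suppf hE.
have le_supp := cLnorm_le_support p1 mS finS af suppf.
set K := support_norm _ _ in le_supp *.
have K0 : 0 <= K.
  rewrite /K /support_norm; case: (p) => [r| |]; rewrite ?ler01//.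
  exact: powR_ge0.
pose F := fun xi => (f xi)%:C%C.
have mF : cmeasurable F by split; [exact: af.1|exact: measurable_cst].
have := est F mF (le_lt_trans le_supp (ltry _)) => estF.
have N0 := Lnorm_ge0 (lebesgue3 R) p (fun x => (Normc.normc (F x))%:E).
have {}estF : (cLnorm (lebesgue5 R) q%:E (extension P Q F) <= (`|C| * K)%:E)%E.
  apply: le_trans estF _; rewrite EFinM.
  apply: (@le_trans _ _ (`|C|%:E * cLnorm (lebesgue3 R) p F)%E).
    by rewrite lee_wpmul2r// lee_fin ler_norm.
  by rewrite lee_wpmul2l// lee_fin.
rewrite -lee_fin -poweR_EFin; apply: le_trans hE _.
have -> : energy (mu3 R) (mu5 R) (cube R) (phase P Q) q f =
    (cLnorm (lebesgue5 R) q%:E (extension P Q F) `^ q)%E.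
  have q_neq0 : q != 0 by rewrite gt_eqF.
  apply/esym/(etrans (poweR_Lnorm (lebesgue5 R) _ q_neq0)).
  transitivity (\int[lebesgue5 R]_x
      ((amplitude (mu3 R) (cube R) (phase P Q) f x) `^ q)%:E)%E.
    apply: eq_integral => x _; rewrite normc_extension abse_EFin ger0_norm//.
    exact: amplitude_ge0.
  exact: integral_lebesgue5.
apply: gt0_ler_poweR => //; first exact: ltW.
- by rewrite in_itv; apply/andP; split; [exact: Lnorm_ge0|exact: leey].
- have CK : (0 <= (`|C| * K)%:E)%E by rewrite lee_fin mulr_ge0.
  by rewrite in_itv; apply/andP; split; [exact: CK|exact: leey].
Qed.

End Extension.

(** * Failure of the estimate *)

Lemma powR_unbounded (R : realType) (c tau B : R) : 0 < c -> 0 < tau ->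
  exists2 n, (0 < n)%N & B < c * n%:R `^ tau.
Proof.
move=> c0 tau0; pose x := (`|B| / c + 1) `^ tau^-1.
have x0 : 0 <= x by exact: powR_ge0.
have xn := archi_boundP x0; set n := Num.bound x in xn.
exists n; first by rewrite -(ltr_nat R) (le_lt_trans x0).
have y0 : 0 <= `|B| / c + 1 by rewrite addr_ge0// divr_ge0// ltW.
have : x `^ tau <= n%:R `^ tau.
  by rewrite ge0_ler_powR ?nnegrE// ltW.
rewrite /x -powRrM mulVf ?gt_eqF// powRr1// -(ler_pM2l c0) => /(lt_le_trans _);
  apply.
rewrite mulrDr mulr1 mulrCA mulfV ?gt_eqF// mulr1.
by rewrite (le_lt_trans (ler_norm _))// ltrDl.
Qed.

Section Failure.
Context (R : realType) (P Q : 'cV[R]_3 -> R).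
Hypotheses (qP : quadratic_form P) (qQ : quadratic_form Q).
Hypothesis hPQ : equivalent_to_model_pair P Q.

Local Notation energyPQ := (energy (mu3 R) (mu5 R) (cube R) (phase P Q)).

Let cube_finite : (mu3 R (cube R) < +oo)%E.
Proof. by rewrite mu3_cube ltry. Qed.

Lemma plates_energy : exists c K : R, [/\ 0 < c, 0 < K &
  forall n, (0 < n)%N -> exists D : nat -> set (space3 R),
    (forall i j, (i < j)%N -> D i `&` D j = set0) /\
    forall j, (j < n)%N -> [/\ measurable (D j), D j `<=` cube R,
      (mu3 R (D j) <= (K / n%:R)%:E)%E &
      forall s, 0 <= s ->
        ((c * (c / 2) `^ s * n%:R `^ (3 - s))%:E <= energyPQ s \1_(D j))%E]].
Proof.
have [c [K [c0 K0 plates]]] := knapp_plates qP qQ hPQ.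
exists c, K; split=> // n n0; have [D [T [theta [disj hD]]]] := plates n n0.
exists D; split=> // j jn.
have [mD subD /andP[mul muu] [mT muT] near] := hD j jn.
split=> // s s0.
have nR : 0 < n%:R :> R by rewrite ltr0n.
have -> : c * (c / 2) `^ s * n%:R `^ (3 - s) =
    (c / n%:R / 2) `^ s * (c * n%:R ^+ 3).
  have -> : c / n%:R / 2 = c / 2 * n%:R^-1 by rewrite mulrAC.
  have c2 : 0 <= c / 2 by rewrite divr_ge0 ?ltW.
  rewrite [(c / 2 / _) `^ s]powRM ?invr_ge0 ?(ltW nR)//.
  rewrite -[n%:R^-1]powR_inv1 ?ltW// -powRrM mulN1r.
  rewrite -[n%:R ^+ 3]powR_mulrn ?ltW// powRD;
    last by rewrite (gt_eqF nR) implybT.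
  by ring.
have m0 : 0 <= c / n%:R by rewrite divr_ge0 ?ltW.
exact: (@energy_indic_ge _ _ _ _ _ (mu3 R) (mu5 R) (cube R) (phase P Q)
  (@measurable_cube R) cube_finite (measurable_phase qP qQ)
  _ _ _ _ _ _ s0 m0 mD subD mul mT muT near).
Qed.

(** All n parallel plates are superposed with the signs of [exists_signs]: the
    energy of exponent s is at least a constant times n n^(3 - s). *)
Lemma no_estimate_below_4 (p : \bar R) (q C : R) : (1 <= p)%E -> 1 <= q < 4 ->
  ~ extension_estimate P Q p q%:E C.
Proof.
move=> p1 /andP[q1 q4] est; have [c [K [c0 K0 plates]]] := plates_energy.
have q0 : 0 < q by exact: lt_le_trans q1.
(* The Clarkson inequality needs an exponent that is at least 2. *)
pose s := Num.max q 2.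
have s2 : 2 <= s by rewrite le_max lexx orbT.
have qs : q <= s by rewrite le_max lexx.
have s4 : s < 4 by rewrite gt_max q4/=; lra.
pose M := (2 * fine (mu3 R (cube R))) `^ (s - q).
have M0 : 0 < M by rewrite powR_gt0// mu3_cube /= mulr_gt0.
pose k := c * (c / 2) `^ s / M.
have k0 : 0 < k by rewrite divr_gt0// mulr_gt0// powR_gt0// divr_gt0.
have t0 : 0 < 4 - s by rewrite subr_gt0.
have [n n0] := powR_unbounded ((`|C| * support_norm p (fine (mu3 R (cube R))))
  `^ q)
  k0 t0.
apply/negP; rewrite -leNgt.
have nR : 0 < n%:R :> R by rewrite ltr0n.
have [D [disj hD]] := plates n n0.
pose L := c * (c / 2) `^ s * n%:R `^ (3 - s).
have mphi := measurable_phase qP qQ.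
have hL j : (j < n)%N -> measurable (D j) /\ (L%:E <= energyPQ s \1_(D j))%E.
  move=> /hD[mD _ _ hE]; split; first exact: mD.
  by apply: hE; exact: le_trans s2.
have clark f g := @energy_clarkson _ _ _ _ _ (mu3 R) (mu5 R) (cube R) (phase P
  Q)
  (@measurable_cube R) cube_finite mphi s f g s2.
have [f [af suppf hf]] := exists_signs (E := energyPQ s) (fun f =>
  energy_ge0 _ _ _ _ _ _) clark disj hL.
have suppf_cube x : f x != 0 -> cube R x.
  by move=> /suppf[j jn Dx]; have [_ + _ _] := hD j jn; apply.
apply: (@energy_le_support R P Q p q C _ (cube R) f p1 q0 est
  (@measurable_cube R) cube_finite af suppf_cube).
have := le_trans hf (@energy_le_energy _ _ _ _ _ (mu3 R) (mu5 R) (cube R)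
  (phase P Q) (@measurable_cube R) cube_finite mphi f q s af q0 qs).
rewrite -/M; set e := energyPQ q f => hM.
have -> : k * n%:R `^ (4 - s) = M^-1 * (n%:R * L).
  have -> : 4 - s = 1 + (3 - s) by ring.
  rewrite powRD; last by rewrite (gt_eqF nR) implybT.
  by rewrite powRr1 ?ltW// /k /L; ring.
rewrite EFinM; apply: le_trans (lee_wpmul2l _ hM) _;
  first by rewrite lee_fin invr_ge0 ltW.
rewrite muleA -EFinM (mulVf (lt0r_neq0 M0)) mul1e; exact: lexx.
Qed.

(** The estimate for one plate of width about 1/n bounds n^(3 - q) by a constant
    times n^(-q/p), and 3 - q + q/p > 0. *)
Lemma no_estimate_below_critical (p q C : R) : 1 <= p -> 4 <= q ->
  p < q / (q - 3) -> ~ extension_estimate P Q p%:E q%:E C.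
Proof.
move=> p1 q4 pq est; have [c [K [c0 K0 plates]]] := plates_energy.
have q0 : 0 < q by exact: lt_le_trans q4.
have p0 : 0 < p by exact: lt_le_trans p1.
pose k := c * (c / 2) `^ q.
have k0 : 0 < k by rewrite mulr_gt0// powR_gt0// divr_gt0.
have t0 : 0 < 3 - q + q / p.
  have q3 : 0 < q - 3 by lra.
  move: pq; rewrite ltr_pdivlMr// mulrC -ltr_pdivlMr// => h; lra.
have [n n0] := powR_unbounded (`|C| `^ q * K `^ (q / p)) k0 t0.
apply/negP; rewrite -leNgt.
have nR : 0 < n%:R :> R by rewrite ltr0n.
have [D [_ /(_ 0%N n0)[mD subD muD hE]]] := plates n n0.
have finD : (mu3 R (D 0%N) < +oo)%E by exact: le_lt_trans muD (ltry _).
have := @energy_le_support R P Q p%:E q C _ _ _ _ q0 est mD finD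
  (admissible_indic R mD) _ (hE q (ltW q0)).
rewrite lee_fin => /(_ p1) h.
have {}h := h _.
have m0 : 0 <= fine (mu3 R (D 0%N)) by rewrite fine_ge0// measure_ge0.
have mK : fine (mu3 R (D 0%N)) <= K / n%:R.
  by rewrite -lee_fin fineK// ge0_fin_numE// measure_ge0.
have {}h : k * n%:R `^ (3 - q) <= (`|C| * (K / n%:R) `^ p^-1) `^ q.
  apply: le_trans (h _) _.
    by move=> x; rewrite indicE; case: (boolP (x \in D 0%N));
      [move=> /set_mem|rewrite eqxx].
  rewrite ge0_ler_powR ?nnegrE ?mulr_ge0 ?powR_ge0 ?(ltW q0)// ler_wpM2l//.
  by rewrite ge0_ler_powR ?nnegrE ?invr_ge0 ?(ltW p0)// divr_ge0// ltW.
have -> : k * n%:R `^ (3 - q + q / p) = k * n%:R `^ (3 - q) * n%:R `^ (q / p).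
  by rewrite powRD ?mulrA// (gt_eqF nR) implybT.
rewrite -ler_pdivlMr ?powR_gt0//; apply: le_trans h _.
rewrite [(_ * _) `^ q]powRM ?powR_ge0// -powRrM [p^-1 * q]mulrC.
rewrite [(K / _) `^ _]powRM ?invr_ge0 ?(ltW K0) ?(ltW nR)//.
by rewrite -[n%:R^-1]powR_inv1 ?(ltW nR)// -powRrM mulN1r powRN mulrA.
Qed.

End Failure.

Theorem theorem1p3 (R : realType) (P Q : 'cV[R]_3 -> R) (p q : \bar R)
    (hP : quadratic_form P) (hQ : quadratic_form Q)
    (hPQ : equivalent_to_model_pair P Q)
    (hp : (1 <= p)%E) (hq : (1 <= q)%E)
    (hpq : (q < 4%:E)%E \/ (4%:E <= q)%E /\ (p < critical_exponent q)%E) :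
  ~ exists C : R, forall f : space3 R -> R[i],
      cmeasurable f ->
      (cLnorm (lebesgue3 R) p f < +oo)%E ->
      (cLnorm (lebesgue5 R) q (extension P Q f) <=
         C%:E * cLnorm (lebesgue3 R) p f)%E.
Proof.
move=> [C est]; case: q hq hpq est => [q|_|//]; last first.
  by move=> [|[_ /= /(le_lt_trans hp)]] //; rewrite ltxx.
rewrite lee_fin => q1 [|[]].
  rewrite lte_fin => q4; apply: no_estimate_below_4 => //.
  by rewrite q1.
rewrite lee_fin => q4; case: p hp => [p| |] //=.
rewrite lee_fin lte_fin => p1 pq; exact: no_estimate_below_critical.
Qed.
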